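(* Let $f:\mathbb{R}\to\mathbb{C}$ be a bounded continuous function with $f(0)=1$. For $z\in\mathbb{C}\setminus\mathbb{R}$ define the modified Cauchy transform \[ K_f(z)=\frac{i}{\pi}\int_{-\infty}^{\infty}\Bigl(\frac{1}{z-t}+\frac{t}{t^2+1}\Bigr)f(t)\,dt . \] Then $f$ is a characteristic function if and only if there is a constant $a_f\in\mathbb{R}$ such that: (i) the function $y\mapsto a_f+K_f(iy)$ is completely monotonic on $(0,\infty)$, and (ii) the function $y\mapsto -\bigl(a_f+K_f(iy)\bigr)$ is absolutely monotonic on $(-\infty,0)$.
   Context: A function $f:\mathbb{R}\to\mathbb{C}$ is a characteristic function if there is a probability measure $\sigma$ on $\mathbb{R}$ with $f(x)=\int_{-\infty}^{\infty}e^{ixt}\,d\sigma(t)$ for all $x\in\mathbb{R}$. A function $\omega:(a,b)\to\mathbb{R}$ ($-\infty\le a<b\le\infty$) is completely monotonic if it is infinitely differentiable and $(-1)^n\omega^{(n)}(x)\ge 0$ for all $x\in(a,b)$ and all $n=0,1,2,\dots$. A function $\omega$ is absolutely monotonic on $(a,b)$ if $x\mapsto\omega(-x)$ is completely monotonic on $(-b,-a)$, equivalently $\omega$ is infinitely differentiable with $\omega^{(n)}(x)\ge0$ for all $x\in(a,b)$ and all $n\ge 0$. (In particular, conditions (i) and (ii) require the respective functions to be real-valued.) *)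

(* Defs.v *)
From HB Require Import structures.
From mathcomp Require Import all_boot all_order all_algebra.
From mathcomp Require Import all_classical all_reals all_analysis.
From mathcomp Require Import complex.
Set Implicit Arguments. Unset Strict Implicit. Unset Printing Implicit Defensive.
Import Order.TTheory GRing.Theory Num.Theory.
Import numFieldNormedType.Exports.
Local Open Scope classical_set_scope.
Local Open Scope ring_scope.
Local Open Scope complex_scope.

Section Defs.
Variable R : realType.

Definition Rint (g : R -> R) : R := Rintegral (@lebesgue_measure R) setT g.

Definition Cint (g : R -> R[i]) : R[i] :=
  (Rint (fun t => complex.Re (g t))) +i* (Rint (fun t => complex.Im (g t))).

Definition Cint_mu (mu : {measure set R -> \bar R}) (g : R -> R[i]) : R[i] :=
  (Rintegral mu setT (fun t => complex.Re (g t))) +i* (Rintegral mu setT (fun t => complex.Im (g t))).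

Definition characteristic_function (f : R -> R[i]) : Prop :=
  exists sigma : probability R R,
    forall x : R, f x = Cint_mu sigma (fun t => cos (x * t) +i* sin (x * t)).

Definition cauchyK (f : R -> R[i]) (z : R[i]) : R[i] :=
  ('i * ((pi : R)^-1)%:C) *
  Cint (fun t => ((z - t%:C)^-1 + (t / (t ^+ 2 + 1))%:C) * f t).

Definition completely_monotonic (a b : \bar R) (w : R -> R) : Prop :=
  (forall n x, (a < x%:E)%E -> (x%:E < b)%E -> derivable (derive1n n w) x 1) /\
  (forall n x, (a < x%:E)%E -> (x%:E < b)%E -> 0 <= (-1) ^+ n * derive1n n w x).

Definition absolutely_monotonic (a b : \bar R) (w : R -> R) : Prop :=
  completely_monotonic (- b)%E (- a)%E (fun x => w (- x)).

End Defs.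

(* Main.v *)
(* Write f = u + i v. On the imaginary axis K_f(iy) splits into the Poisson
   integrals of u and v, which are odd in y, and their conjugate Poisson
   integrals, which are even in y.

   If f is the characteristic function of sigma, the Fourier transforms of the
   two kernels give, for y > 0 and a_f the integral of sgn(s) exp(-|s|),
     a_f + K_f(iy) = int (1 + sgn s) exp(-y |s|) dsigma(s),
     -(a_f + K_f(-iy)) = int (1 - sgn s) exp(-y |s|) dsigma(s),
   both Laplace transforms of positive measures.

   Conversely, the two functions are completely monotonic, and bounded because
   their sum is a Poisson integral of u; by Bernstein's theorem their halves are
   Laplace transforms of finite measures on [0, oo[. The sum of the first measure
   and of the reflection of the second one has a Fourier transform whose Poisson
   and conjugate Poisson integrals are those of f (the vanishing of the imaginary
   parts of a_f + K_f(iy) and a_f + K_f(-iy) takes care of the remaining two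
   integrals). A bounded continuous function is determined by these integrals:
   its even and odd parts have a vanishing Stieltjes transform, hence vanishing
   moments in the variable 1 / (1 + t^2).

   Bernstein's theorem is obtained by discretizing: the Taylor expansion at a
   large point gives weights whose quantile functions are monotone and uniformly
   bounded, and an ultrafilter limit of them is the quantile function of the
   representing measure. *)

Require Import Defs.
From HB Require Import structures.
From mathcomp Require Import all_boot all_order all_algebra.
From mathcomp Require Import all_classical all_reals all_analysis.
From mathcomp Require Import complex.
From mathcomp Require Import measurable_realfun.
From mathcomp Require Import ring lra.
Set Implicit Arguments. Unset Strict Implicit. Unset Printing Implicit Defensive.
Import Order.TTheory GRing.Theory Num.Theory.
Import numFieldNormedType.Exports.
Local Open Scope classical_set_scope.
Local Open Scope ring_scope.

(** * Uniqueness of moments and of Stieltjes transforms *)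

Section Moments.
Context {R : realType}.
Implicit Types (c y s : R).

Lemma integrable_bounded_mul d (T : measurableType d)
    (mu : {measure set T -> \bar R}) (M : R) (h k : T -> R) :
  measurable_fun setT h -> (forall t, `|h t| <= M) ->
  mu.-integrable setT (EFin \o k) ->
  mu.-integrable setT (EFin \o (fun t => h t * k t)).
Proof.
move=> mh hM ik.
apply: (@le_integrable _ _ _ _ _ _ _ (fun t => (M%:E * (EFin \o k) t)%E)) => //.
- apply/measurable_EFinP/measurable_funM => //.
  exact/measurable_EFinP/(measurable_int mu).
- move=> t _ /=; rewrite lee_fin !normrM ler_wpM2r//.
  by rewrite (le_trans (hM t))// ler_norm.
- exact: integrableZl.
Qed.

Lemma integrable_scale d (T : measurableType d)
    (mu : {measure set T -> \bar R}) (c : R) (k : T -> R) :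
  mu.-integrable setT (EFin \o k) ->
  mu.-integrable setT (EFin \o (fun t => c * k t)).
Proof. exact: (@integrable_bounded_mul _ _ _ `|c| (cst c)). Qed.

(** Horner's scheme: [p * 'X + c] against [k] is [p] against [x * k] plus a multiple of the integral
    of [k], and the moments of [x * k] are shifted moments of [k]. Hence [k] varies in the
    induction. *)
Lemma Rintegral_poly_eq0 d (T : measurableType d)
    (mu : {measure set T -> \bar R}) (x : T -> R) (p : {poly R}) :
  measurable_fun setT x -> (forall t, 0 <= x t <= 1) ->
  forall k : T -> R, mu.-integrable setT (EFin \o k) ->
  (forall n, \int[mu]_t (x t ^+ n * k t) = 0) ->
  \int[mu]_t (p.[x t] * k t) = 0.
Proof.
move=> mx x01; elim/poly_ind: p => [k _ _|p c IH k ik Hk].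
  by under eq_Rintegral do rewrite horner0 mul0r; rewrite Rintegral_cst// mul0r.
have x1 t : `|x t| <= 1 by have /andP[? ?] := x01 t; rewrite ger0_norm.
have ikx : mu.-integrable setT (EFin \o (fun t => x t * k t)).
  exact: integrable_bounded_mul x1 ik.
have mp : measurable_fun setT (fun t => p.[x t]).
  apply: (measurableT_comp (f := fun y => p.[y])) => //.
  by apply: continuous_measurable_fun; exact: continuous_horner.
have bp : exists M : R, forall t, `|p.[x t]| <= M.
  exists (\sum_(i < size p) `|p`_i|) => t.
  rewrite horner_coef (le_trans (ler_norm_sum _ _ _))// ler_sum// => i _.
  by rewrite normrM ler_piMr// normrX exprn_ile1.
have [M bM] := bp.
have -> : \int[mu]_t ((p * 'X + c%:P).[x t] * k t) =
          \int[mu]_t (p.[x t] * (x t * k t) + c * k t).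
  by apply: eq_Rintegral => t _; rewrite hornerD hornerM hornerX hornerC mulrDl -mulrA.
rewrite RintegralD//; last 2 first.
- exact: integrable_bounded_mul bM ikx.
- by apply: (@integrable_bounded_mul _ _ _ `|c|) => //; exact: measurable_cst.
rewrite IH// ?RintegralZl// => [|n].
  by have := Hk 0; under eq_Rintegral do rewrite expr0 mul1r; move=> ->; rewrite mulr0 addr0.
by rewrite -[RHS](Hk n.+1); apply: eq_Rintegral => t _; rewrite exprSr; ring.
Qed.

(* The integrals of [k] against the Landau kernels [(1 - (x - x0)^2)^n] vanish,
   although these kernels concentrate where [x] is close to [x0], where [k] is
   positive. *)
Lemma moments_not_all_zero (k x : R -> R) (x0 eta kappa a b : R) :
  (@lebesgue_measure R).-integrable setT (EFin \o k) ->
  measurable_fun setT x -> (forall t, 0 <= x t <= 1) -> 0 <= x0 <= 1 ->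
  0 < eta <= 1 -> 0 < kappa -> a < b ->
  (forall t, `|x t - x0| < eta -> 0 <= k t) ->
  (forall t, a <= t <= b -> `|x t - x0| <= eta / 2 /\ kappa <= k t) ->
  ~ (forall n, \int[@lebesgue_measure R]_t (x t ^+ n * k t) = 0).
Proof.
set mu := @lebesgue_measure R.
move=> ik mx x01 x001 /andP[eta0 eta1] kappa0 ab Hpos Hpeak Hmom.
pose q t := 1 - (x t - x0) ^+ 2.
(* The Landau factor [q] is at most [c] where |x - x0| >= eta and at least [be] on [a, b], where |x
   - x0| <= eta / 2. *)
pose c := 1 - eta ^+ 2; pose be := 1 - eta ^+ 2 / 4.
have c0 : 0 <= c by rewrite /c; nra.
have cbe : c < be by rewrite /c /be; nra.
have be0 : 0 < be by exact: le_lt_trans cbe.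
have be1 : be <= 1 by rewrite /be; nra.
have q01 t : 0 <= q t <= 1.
  have /andP[? ?] := x01 t; have /andP[? ?] := x001; rewrite /q.
  have : `|x t - x0| <= 1 by rewrite ler_norml; apply/andP; split; lra.
  rewrite -[_ ^+ 2]real_normK ?num_real//; have := normr_ge0 (x t - x0).
  by move=> ? ?; apply/andP; split; nra.
have mq : measurable_fun setT q.
  by apply: measurable_funB => //; apply: measurable_funX; apply: measurable_funB.
have qn1 n t : `|q t ^+ n| <= 1.
  have /andP[q0 q1] := q01 t.
  by rewrite normrX exprn_ile1// ger0_norm.
have mI : measurable `[a, b] by [].
have iI : mu.-integrable setT (EFin \o (\1_`[a, b] : R -> R)).
  by apply: integrable_indic_itv.
have Iab : \int[mu]_t (\1_`[a, b] t) = b - a.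
  have lab : mu `[a, b]%classic = (b - a)%:E.
    by rewrite /mu lebesgue_measure_itv/= lte_fin ab.
  by rewrite /Rintegral integral_indic// setIT [X in fine X]lab.
have iak : mu.-integrable setT (EFin \o (fun t => `|k t|)).
  exact: integrable_norm.
pose K := \int[mu]_t `|k t|.
(* Integrates the pointwise bound of [q ^+ n * k] from below by [kappa * be ^+ n] on [a, b] minus
   [c ^+ n] times |k|; the integral of [q ^+ n * k] is 0. Since [c < be], dividing by [be ^+ n] and
   letting n grow is contradictory. *)
have main n : kappa * be ^+ n * (b - a) <= c ^+ n * K.
  have Q0 : \int[mu]_t (q t ^+ n * k t) = 0.
    pose p : {poly R} := (1 - ('X - x0%:P) ^+ 2) ^+ n.
    rewrite -(@Rintegral_poly_eq0 _ _ mu x p mx x01 k ik Hmom).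
    by apply: eq_Rintegral => t _; rewrite /p !hornerE/= /q.
  have i1 : mu.-integrable setT (EFin \o (fun t => kappa * be ^+ n * \1_`[a, b] t)).
    apply: (@integrable_bounded_mul _ _ _ `|kappa * be ^+ n|) => //.
  have i2 : mu.-integrable setT (EFin \o (fun t => c ^+ n * `|k t|)).
    by apply: (@integrable_bounded_mul _ _ _ `|c ^+ n|).
  rewrite -Iab -RintegralZl// /K -RintegralZl// -subr_le0 -RintegralB// -Q0.
  apply: le_Rintegral => //.
  - have := integrableB measurableT i1 i2.
    by apply: eq_integrable.
  - apply: (integrable_bounded_mul (M := 1)) => //.
    exact: measurable_funX.
  move=> t _; have cn0 : 0 <= c ^+ n by exact: exprn_ge0.
  have /andP[q0 _] := q01 t; have qn0 : 0 <= q t ^+ n by exact: exprn_ge0.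
  have ak0 : 0 <= c ^+ n * `|k t| by exact: mulr_ge0.
  rewrite indicE; have [/set_mem/=|_] := boolP (t \in _).
    rewrite in_itv/= => /Hpeak[xt kt]; rewrite mulr1.
    rewrite lerBlDr (le_trans _ (ler_wpDr ak0 (lexx _)))//.
    rewrite mulrC ler_pM ?exprn_ge0 ?(ltW be0) ?(ltW kappa0)//.
    rewrite lerXn2r ?nnegrE ?(ltW be0)// /be /q.
    move: xt; rewrite ler_norml => /andP[? ?]; nra.
  rewrite mulr0 sub0r; have [xt|xt] := ltP `|x t - x0| eta.
    by rewrite (@le_trans _ _ 0) ?oppr_le0// mulr_ge0// Hpos.
  have qc : q t ^+ n <= c ^+ n.
    rewrite lerXn2r ?nnegrE// /q /c lerD2l lerN2.
    by rewrite -[leRHS]real_normK ?num_real// lerXn2r// nnegrE ltW.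
  have := ler_norm (- k t); rewrite normrN => kt.
  by have := normr_ge0 (k t); nra.
have K0 : 0 <= K by apply: Rintegral_ge0.
pose r := c / be.
have r01 : 0 <= r < 1 by rewrite /r divr_ge0 ?(ltW be0)//= ltr_pdivrMr// mul1r.
have main' n : kappa * (b - a) <= r ^+ n * K.
  have ben : 0 < be ^+ n by exact: exprn_gt0.
  rewrite /r expr_div_n mulrAC ler_pdivlMr//; have := main n.
  by rewrite mulrAC.
have cv : (fun n => r ^+ n * K) @ \oo --> 0 * K.
  apply: cvgMr_tmp; apply: cvg_expr.
  by have /andP[? ?] := r01; rewrite ger0_norm.
rewrite mul0r in cv.
have : kappa * (b - a) <= 0.
  apply: (ler_cvg_to (cvg_cst (kappa * (b - a))) cv).
  by apply: nearW => n /=.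
by apply/negP; rewrite -ltNge mulr_gt0// subr_gt0.
Qed.

(** By symmetry under [k -> - k], suppose k t0 > 0. As x is strictly decreasing in |t|, x t is close
    to x t0 only when |t| is close to |t0|, and there k is positive by evenness and continuity; this
    contradicts [moments_not_all_zero]. *)
Lemma even_moments_eq0 (k x : R -> R) (t0 : R) :
  (@lebesgue_measure R).-integrable setT (EFin \o k) ->
  (forall t, k (- t) = k t) ->
  measurable_fun setT x -> (forall t, 0 <= x t <= 1) ->
  (forall s t, `|s| < `|t| -> x t < x s) ->
  {for t0, continuous x} -> {for t0, continuous k} ->
  (forall n, \int[@lebesgue_measure R]_t (x t ^+ n * k t) = 0) ->
  k t0 = 0.
Proof.
move=> ik ek mx x01 xdec cx ck Hmom.
suff Hle (g : R -> R) : (@lebesgue_measure R).-integrable setT (EFin \o g) ->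
    (forall t, g (- t) = g t) -> {for t0, continuous g} ->
    (forall n, \int[@lebesgue_measure R]_t (x t ^+ n * g t) = 0) -> g t0 <= 0.
  apply/eqP; rewrite eq_le Hle//= -oppr_le0 (Hle (fun t => - k t))//.
  - by have := integrableN ik; apply: eq_integrable.
  - by move=> t; rewrite ek.
  - exact: cvgN.
  - move=> n; have /eqP := Hmom n; rewrite -oppr_eq0 => /eqP <-.
    rewrite -[RHS]mulN1r -RintegralZl//.
      by apply: eq_Rintegral => t _; ring.
    apply: (integrable_bounded_mul (M := 1)) => //; first exact: measurable_funX.
    by move=> t; have /andP[? ?] := x01 t; rewrite normrX exprn_ile1// ger0_norm.
move=> {ik ek ck Hmom}ig eg cg Hmom; rewrite leNgt; apply/negP => gt0.
have g20 : 0 < g t0 / 2 by rewrite divr_gt0.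
have /cvgrPdist_lt/(_ _ g20)/nbhs_ballP[d /= d0 gd] := cg.
have {}gd t : `|t0 - t| < d -> g t0 / 2 < g t.
  by move=> /gd; rewrite ltr_norml => /andP[_]; lra.
set x0 := x t0; set a0 := `|t0|.
have a00 : 0 <= a0 by exact: normr_ge0.
(* [e1] and [e2] are the gaps of x outside the annulus where |t| is within d of a0: [e1] on the
   outer side, [e2] on the inner side. *)
pose e1 := x0 - x (a0 + d / 2).
have e10 : 0 < e1.
  by rewrite subr_gt0 xdec// [ltRHS]ger0_norm/a0//; move: a00; rewrite /a0; lra.
have e11 : e1 <= 1.
  by rewrite /e1; have /andP[? ?] := x01 t0; have /andP[? ?] := x01 (a0 + d / 2); rewrite /x0; lra.
have [e2 e20 He2] : exists2 e2, 0 < e2 & forall t, `|t| <= a0 - d -> e2 <= x t - x0.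
  (* If a0 < d there is no point on the inner side, and any positive gap will do. *)
  have [da|ad] := leP d a0; last first.
    by exists 1 => // t; have := normr_ge0 t; lra.
  exists (x (a0 - d / 2) - x0).
    by rewrite subr_gt0 xdec// [ltLHS]ger0_norm -/a0//; lra.
  by move=> t ta; rewrite lerD2r ltW// xdec// [ltRHS]ger0_norm; lra.
pose eta := Num.min e1 e2.
have eta0 : 0 < eta by rewrite lt_min e10.
have eta1 : eta <= 1 by rewrite ge_min e11.
have eta20 : 0 < eta / 2 by rewrite divr_gt0.
have /cvgrPdist_lt/(_ _ eta20)/nbhs_ballP[d' /= d'0 xd] := cx.
pose r := Num.min d d' / 2.
have r0 : 0 < r by rewrite divr_gt0// lt_min d0.
have rd : r < d by rewrite /r ltr_pdivrMr// gt_min; apply/orP; left; lra.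
have rd' : r < d' by rewrite /r ltr_pdivrMr// gt_min; apply/orP; right; lra.
apply: (@moments_not_all_zero g x x0 eta (g t0 / 2) (t0 - r) (t0 + r)) => //.
- exact: x01.
- by rewrite eta0.
- lra.
- move=> t xt.
  have td : `| a0 - `|t| | < d.
    rewrite ltNge; apply/negP; rewrite ler_normr => /orP[H|H].
      have /He2 : `|t| <= a0 - d by lra.
      move: xt; rewrite ltr_norml lt_min => /andP[_ /andP[_ ?]]; lra.
    have : x t < x (a0 + d / 2) by rewrite xdec// [ltLHS]ger0_norm; lra.
    move: xt; rewrite ltr_norml => /andP[+ _].
    have : eta <= e1 by rewrite ge_min lexx.
    rewrite /e1; lra.
  have gabs s : g `|s| = g s by case: (ger0P s) => // _; rewrite eg.
  have [t00|t00] := leP 0 t0.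
    rewrite -gabs ltW// (lt_trans g20)// gd//.
    by move: td; rewrite /a0 (ger0_norm t00).
  rewrite -gabs -eg ltW// (lt_trans g20)// gd//.
  move: td; rewrite /a0 (ltr0_norm t00) -normrN.
  by congr (`| _ | < _); ring.
- move=> t /andP[t1 t2].
  have tr : `|t0 - t| <= r by rewrite ler_norml; apply/andP; split; lra.
  split; last by rewrite ltW// gd// (le_lt_trans tr).
  by rewrite distrC ltW// xd//= /ball/= (le_lt_trans tr).
Qed.

Lemma measurable_fun_invr d (T : measurableType d) (x : T -> R) :
  measurable_fun setT x -> (forall t, 0 < x t) ->
  measurable_fun setT (fun t => (x t)^-1).
Proof.
move=> mx x0.
have -> : (fun t => (x t)^-1) = (fun t => expR (- ln (x t))).
  by apply/funext => t; rewrite expRN lnK// posrE.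
apply: measurableT_comp => //; apply: measurableT_comp => //.
exact: measurableT_comp.
Qed.

(** From 1 - 1 / (1 + c x) = c x / (1 + c x), the integral of [k] is c times an integral bounded
    uniformly in c, so it vanishes as c tends to 0. Dividing the identity by c then gives the same
    hypothesis for [x * k]. *)
Lemma stieltjes_moments_step d (T : measurableType d)
    (mu : {measure set T -> \bar R}) (x : T -> R) (k : T -> R) :
  measurable_fun setT x -> (forall t, 0 <= x t <= 1) ->
  mu.-integrable setT (EFin \o k) ->
  (forall c, 0 < c -> \int[mu]_t ((1 + c * x t)^-1 * k t) = 0) ->
  \int[mu]_t (k t) = 0 /\
  (forall c, 0 < c -> \int[mu]_t ((1 + c * x t)^-1 * (x t * k t)) = 0).
Proof.
move=> mx x01 ik Hk.
have x1 t : `|x t| <= 1 by have /andP[? ?] := x01 t; rewrite ger0_norm.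
have ikx : mu.-integrable setT (EFin \o (fun t => x t * k t)).
  exact: integrable_bounded_mul x1 ik.
have pos c t : 0 < c -> 0 < 1 + c * x t.
  by move=> c0; have /andP[? ?] := x01 t; rewrite ltr_pwDl// mulr_ge0// ltW.
have mc c : 0 < c -> measurable_fun setT (fun t => (1 + c * x t)^-1).
  move=> c0; apply: measurable_fun_invr => [|t]; last exact: pos.
  by apply: measurable_funD => //; apply: measurable_funM.
have bc c t : 0 < c -> `|(1 + c * x t)^-1| <= 1.
  move=> c0; rewrite gtr0_norm ?invr_gt0 ?pos// invf_le1 ?pos// lerDl.
  by have /andP[? ?] := x01 t; rewrite mulr_ge0// ltW.
have E c : 0 < c -> \int[mu]_t k t =
    c * \int[mu]_t ((1 + c * x t)^-1 * (x t * k t)).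
  move=> c0; rewrite -RintegralZl//; last first.
    by apply: (integrable_bounded_mul (M := 1)) => // [|t]; [exact: mc|exact: bc].
  rewrite -[LHS]subr0 -{1}(Hk c c0) -RintegralB//; last first.
    by apply: (integrable_bounded_mul (M := 1)) => // [|t]; [exact: mc|exact: bc].
  by apply: eq_Rintegral => t _; have := pos c t c0 => /lt0r_neq0 ?; field.
have [G G0 HG] : exists2 G, 0 <= G & forall c, 0 < c ->
    `|\int[mu]_t ((1 + c * x t)^-1 * (x t * k t))| <= G.
  exists (\int[mu]_t `|x t * k t|); first exact: Rintegral_ge0.
  move=> c c0.
  have ic : mu.-integrable setT (EFin \o (fun t => (1 + c * x t)^-1 * (x t * k t))).
    by apply: (integrable_bounded_mul (M := 1)) => // [|t]; [exact: mc|exact: bc].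
  rewrite (le_trans (le_normr_Rintegral _ _))//.
  apply: le_Rintegral => //; [exact: integrable_norm..|].
  by move=> t _; rewrite normrM ler_piMl// bc.
have k0 : \int[mu]_t k t = 0.
  apply/eqP; rewrite -normr_le0 leNgt; apply/negP => I0.
  set I := \int[mu]_t k t in I0.
  have G1 : 0 < G + 1 by lra.
  (* With this c the product c * G stays below |I|, which the identity [E] forbids. *)
  pose c := `|I| / (G + 1).
  have c0 : 0 < c by rewrite divr_gt0.
  have := HG c c0; have := E c c0; rewrite -/I => EI.
  have : `|I| = c * `|\int[mu]_t ((1 + c * x t)^-1 * (x t * k t))|.
    by rewrite {1}EI normrM gtr0_norm.
  set J := `| \int[mu]_t _ |; rewrite {1}/c => H JG.
  have : `|I| * (G + 1) = `|I| * J.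
    rewrite {1}H; field; exact: lt0r_neq0.
  move/mulfI; rewrite normr_eq0 => /(_ _) HJ.
  have : G + 1 = J by apply: HJ; rewrite -normr_gt0.
  lra.
split=> // c c0; have /eqP := E c c0.
by rewrite k0 eq_sym mulf_eq0 gt_eqF//= => /eqP.
Qed.

Lemma stieltjes_moments d (T : measurableType d)
    (mu : {measure set T -> \bar R}) (x : T -> R) (k : T -> R) :
  measurable_fun setT x -> (forall t, 0 <= x t <= 1) ->
  mu.-integrable setT (EFin \o k) ->
  (forall c, 0 < c -> \int[mu]_t ((1 + c * x t)^-1 * k t) = 0) ->
  forall n, \int[mu]_t (x t ^+ n * k t) = 0.
Proof.
move=> mx x01 ik Hk n.
elim: n k ik Hk => [|n IH] k ik Hk; last first.
  have x1 t : `|x t| <= 1 by have /andP[? ?] := x01 t; rewrite ger0_norm.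
  under eq_Rintegral do rewrite exprSr -mulrA.
  apply: IH; first exact: integrable_bounded_mul x1 ik.
  by have [] := stieltjes_moments_step mx x01 ik Hk.
under eq_Rintegral do rewrite expr0 mul1r.
by have [] := stieltjes_moments_step mx x01 ik Hk.
Qed.

End Moments.

(** * Fourier transforms of the Cauchy kernel and of its conjugate *)

Section FourierIntegrals.
Context {R : realType}.
Local Notation mu := (@lebesgue_measure R).

(** [g] is a smooth expression that agrees with [f] on the nonnegative half-line, so that an
    integrand written with |s| never has to be differentiated at 0. *)
Lemma even_integral_FTC (f F g : R -> R) (l : R) :
  (forall x, 0 <= f x) -> continuous f -> (forall x, f (- x) = f x) ->
  F x @[x --> +oo] --> l ->
  (forall x : R, is_derive x 1 F (g x)) -> (forall x, 0 <= x -> f x = g x) ->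
  mu.-integrable setT (EFin \o f) /\ \int[mu]_t f t = 2 * (l - F 0).
Proof.
move=> f0 cf ef Fl dF fg.
have E : (\int[mu]_t (f t)%:E = (2 * (l - F 0))%:E)%E.
  rewrite ge0_symfun_integralT//; last by move=> x /=; rewrite ef.
  rewrite EFinM -set_itvcy; congr (_ * _)%E.
  rewrite (@ge0_continuous_FTC2y _ f F 0 l)//.
  - exact: continuous_subspaceT.
  - apply: cvg_at_right_filter; apply: differentiable_continuous.
    exact/derivable1_diffP/ex_derive.
  - move=> x; rewrite in_itv/= andbT => x0.
    by rewrite derive1E derive_val fg// ltW.
split; last by rewrite /Rintegral E.
apply/integrableP; split.
  by apply/measurable_EFinP; exact: continuous_measurable_fun.
under eq_integral => x _ do rewrite gee0_abs ?lee_fin//.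
by rewrite [ltLHS]E ltry.
Qed.

Lemma is_derive_scale (a x : R) : is_derive x 1 (fun y => a * y) a.
Proof.
by apply: (is_derive_eq (is_deriveZ a (is_derive_id x 1))); rewrite /GRing.scale/= mulr1.
Qed.

Lemma is_derive_comp_scale (h : R -> R) (dh a x : R) :
  is_derive (a * x) 1 h dh -> is_derive x 1 (fun y => h (a * y)) (a * dh).
Proof.
move=> dh'; rewrite mulrC.
exact: (is_derive1_comp (g := fun y => a * y) dh' (is_derive_scale a x)).
Qed.

Lemma is_derive_mul (f g : R -> R) (df dg x : R) :
  is_derive x 1 f df -> is_derive x 1 g dg ->
  is_derive x 1 (fun y => f y * g y) (f x * dg + g x * df).
Proof. exact: is_deriveM. Qed.

Lemma cvgy_expR_scale (a : R) : 0 < a -> expR (- a * x) @[x --> +oo] --> (0 : R).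
Proof.
move=> a0.
have -> : (fun x => expR (- a * x)) = (fun x : R => expR (- x)) \o (fun x => a * x).
  by apply/funext => x /=; rewrite mulNr.
apply: (cvg_comp _ _ _ (@cvgr_expR R)).
by apply: (gt0_cvgMry a0); exact: cvg_id.
Qed.

Lemma cauchy_kernel_integral (a : R) : 0 < a ->
  mu.-integrable setT (EFin \o (fun t => (t ^+ 2 + a ^+ 2)^-1)) /\
  \int[mu]_t (t ^+ 2 + a ^+ 2)^-1 = pi / a.
Proof.
move=> a0.
have pos t : 0 < t ^+ 2 + a ^+ 2 by rewrite ltr_wpDl ?sqr_ge0// exprn_gt0.
pose F t := a^-1 * atan (a^-1 * t).
have -> : pi / a = 2 * (a^-1 * (pi / 2) - F 0).
  by rewrite /F mulr0 atan0 mulr0 subr0; field; rewrite gt_eqF.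
apply: (@even_integral_FTC _ F (fun t => (t ^+ 2 + a ^+ 2)^-1)) => //.
- by move=> t; rewrite invr_ge0 ltW.
- move=> t; apply: cvgV; first by rewrite gt_eqF.
  by apply: cvgD; [exact: exprn_continuous|exact: cvg_cst].
- by move=> t; rewrite sqrrN.
- apply: cvgMl_tmp.
  have ia0 : 0 < a^-1 by rewrite invr_gt0.
  apply: (cvg_comp (fun x : R => a^-1 * x) (@atan R) _ (@cvgy_atan R)).
  by apply: (gt0_cvgMry ia0); exact: cvg_id.
- move=> t.
  have d1 := is_derive_comp_scale (is_derive1_atan (a^-1 * t)).
  apply: (is_derive_eq (is_deriveZ a^-1 d1)); rewrite /GRing.scale/=.
  have := pos t => /lt0r_neq0 p0; have ? := lt0r_neq0 a0.
  field; rewrite p0 ?andbT//.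
Qed.

Lemma cvgy_expR_bounded (a C : R) (h : R -> R) : 0 < a ->
  (forall x, `|h x| <= C) -> expR (- a * x) * h x @[x --> +oo] --> (0 : R).
Proof.
move=> a0 hC; apply: norm_cvg0.
have e0 : C * expR (- a * x) @[x --> +oo] --> (0 : R).
  by rewrite -[X in _ --> X](mulr0 C); apply: cvgMl_tmp; exact: cvgy_expR_scale.
apply: (squeeze_cvgr (f := cst 0) _ (cvg_cst _) e0).
apply: nearW => x /=; rewrite normr_ge0/= normrM ger0_norm ?expR_ge0//.
by rewrite mulrC ler_wpM2r// expR_ge0.
Qed.

Lemma is_derive_expR_scale (a x : R) :
  is_derive x 1 (fun y => expR (- a * y)) (- a * expR (- a * x)).
Proof. exact: is_derive_comp_scale. Qed.

Lemma continuous_expR_abs (a : R) : continuous (fun s : R => expR (- a * `|s|)).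
Proof.
move=> s; apply: continuous_comp; last exact: continuous_expR.
by apply: cvgMl_tmp; exact: norm_continuous.
Qed.

Lemma expR_abs_integral (a : R) : 0 < a ->
  mu.-integrable setT (EFin \o (fun s => expR (- a * `|s|))) /\
  \int[mu]_s expR (- a * `|s|) = 2 / a.
Proof.
move=> a0; pose F s := expR (- a * s) * - a^-1.
have -> : 2 / a = 2 * (0 - F 0).
  by rewrite /F mulr0 expR0; field; rewrite gt_eqF.
apply: (@even_integral_FTC _ F (fun s => expR (- a * s))) => //.
- exact: continuous_expR_abs.
- by move=> s; rewrite normrN.
- exact: (@cvgy_expR_bounded a `|- a^-1| (cst (- a^-1))).
- move=> s.
  apply: (is_derive_eq (is_derive_mul (is_derive_expR_scale a s)
    (is_derive_cst (- a^-1) s 1))).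
  by rewrite /cst; field; exact: lt0r_neq0.
- by move=> s s0; rewrite ger0_norm.
Qed.

(** The derivative of exp(-a s) H(s) is exp(-a s) (H' - a H) = exp(-a s) h(s). [even_integral_FTC]
    asks for a nonnegative integrand, so it is applied to 1 + h and the integral of exp(-a |s|) is
    subtracted. *)
Lemma laplace_even (a C : R) (h H dH : R -> R) : 0 < a ->
  continuous h -> (forall s, `|h s| <= 1) ->
  (forall s : R, is_derive s 1 H (dH s)) -> (forall s, `|H s| <= C) ->
  (forall s, dH s - a * H s = h s) ->
  \int[mu]_s (h `|s| * expR (- a * `|s|)) = - 2 * H 0.
Proof.
move=> a0 ch h1 dHd HC HE.
have [ie Ie] := expR_abs_integral a0.
pose F s := expR (- a * s) * (H s - a^-1).
pose f (s : R) := expR (- a * `|s|) * (1 + h `|s|).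
have chn : continuous (fun s : R => h `|s|).
  by move=> s; apply: continuous_comp; [exact: norm_continuous|exact: ch].
have [If Ef] : mu.-integrable setT (EFin \o f) /\
    \int[mu]_s f s = 2 * (0 - F 0).
  apply: (@even_integral_FTC _ F (fun s => expR (- a * s) * (1 + h s))) => //.
  - move=> s; rewrite mulr_ge0 ?expR_ge0//.
    by have := h1 `|s|; rewrite ler_norml => /andP[? _]; lra.
  - move=> s; apply: cvgM; first exact: continuous_expR_abs.
    by apply: cvgD; [exact: cvg_cst|exact: chn].
  - by move=> s; rewrite /f normrN.
  - apply: (@cvgy_expR_bounded a (C + a^-1)) => // s.
    rewrite (le_trans (ler_normB _ _))// lerD//.
    by rewrite ger0_norm// invr_ge0 ltW.
  - move=> s.
    have dHa : is_derive s 1 (fun y => H y - a^-1) (dH s).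
      apply: (is_derive_eq (is_deriveB (dHd s) (is_derive_cst a^-1 s 1))).
      by rewrite subr0.
    apply: (is_derive_eq (is_derive_mul (is_derive_expR_scale a s) dHa)).
    by rewrite -HE; field; exact: lt0r_neq0.
  - by move=> s s0; rewrite /f ger0_norm.
have -> : \int[mu]_s (h `|s| * expR (- a * `|s|)) =
          \int[mu]_s (f s - expR (- a * `|s|)).
  by apply: eq_Rintegral => s _; rewrite /f; ring.
rewrite RintegralB// Ef Ie /F mulr0 expR0; field; exact: lt0r_neq0.
Qed.

Lemma laplace_cos (a t : R) : 0 < a ->
  \int[mu]_s (cos (`|s| * t) * expR (- a * `|s|)) = 2 * a / (t ^+ 2 + a ^+ 2).
Proof.
move=> a0.
have pos : 0 < t ^+ 2 + a ^+ 2 by rewrite ltr_wpDl ?sqr_ge0// exprn_gt0.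
(* The bounded solution of H' - a H = cos (t s). *)
pose H s := (t ^+ 2 + a ^+ 2)^-1 * (t * sin (t * s) - a * cos (t * s)).
pose dH s := (t ^+ 2 + a ^+ 2)^-1 * (t ^+ 2 * cos (t * s) + a * t * sin (t * s)).
under eq_Rintegral do rewrite (mulrC _ t).
transitivity (- 2 * H 0); last first.
  by rewrite /H mulr0 sin0 cos0; field; exact: lt0r_neq0.
apply: (@laplace_even a (`|(t ^+ 2 + a ^+ 2)^-1| * (`|t| + `|a|))
  (fun s => cos (t * s)) H dH) => //.
- move=> s; apply: continuous_comp; last exact: continuous_cos.
  by apply: cvgMl_tmp; exact: cvg_id.
- by move=> s; rewrite ler_norml cos_geN1 cos_le1.
- move=> s.
  have ds := is_deriveZ t (is_derive_comp_scale (is_derive_sin (t * s))).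
  have dc := is_deriveZ a (is_derive_comp_scale (is_derive_cos (t * s))).
  apply: (is_derive_eq (is_deriveZ (t ^+ 2 + a ^+ 2)^-1 (is_deriveB ds dc))).
  by rewrite /dH /GRing.scale/=; ring.
- move=> s; rewrite normrM ler_wpM2l// (le_trans (ler_normB _ _))//.
  by rewrite lerD// normrM ler_piMr// ler_norml ?cos_geN1 ?cos_le1 ?sin_geN1 ?sin_le1.
- by move=> s; rewrite /dH /H; field; exact: lt0r_neq0.
Qed.

Lemma laplace_sin (a t : R) : 0 < a ->
  \int[mu]_s (sin (`|s| * t) * expR (- a * `|s|)) = 2 * t / (t ^+ 2 + a ^+ 2).
Proof.
move=> a0.
have pos : 0 < t ^+ 2 + a ^+ 2 by rewrite ltr_wpDl ?sqr_ge0// exprn_gt0.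
(* The bounded solution of H' - a H = sin (t s). *)
pose H s := - (t ^+ 2 + a ^+ 2)^-1 * (a * sin (t * s) + t * cos (t * s)).
pose dH s := - (t ^+ 2 + a ^+ 2)^-1 * (a * t * cos (t * s) - t ^+ 2 * sin (t * s)).
under eq_Rintegral do rewrite (mulrC _ t).
transitivity (- 2 * H 0); last first.
  by rewrite /H mulr0 sin0 cos0; field; exact: lt0r_neq0.
apply: (@laplace_even a (`|- (t ^+ 2 + a ^+ 2)^-1| * (`|a| + `|t|))
  (fun s => sin (t * s)) H dH) => //.
- move=> s; apply: continuous_comp; last exact: continuous_sin.
  by apply: cvgMl_tmp; exact: cvg_id.
- by move=> s; rewrite ler_norml sin_geN1 sin_le1.
- move=> s.
  have ds := is_deriveZ a (is_derive_comp_scale (is_derive_sin (t * s))).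
  have dc := is_deriveZ t (is_derive_comp_scale (is_derive_cos (t * s))).
  apply: (is_derive_eq (is_deriveZ (- (t ^+ 2 + a ^+ 2)^-1) (is_deriveD ds dc))).
  by rewrite /dH /GRing.scale/=; ring.
- move=> s; rewrite normrM ler_wpM2l// (le_trans (ler_normD _ _))//.
  by rewrite lerD// normrM ler_piMr// ler_norml ?cos_geN1 ?cos_le1 ?sin_geN1 ?sin_le1.
- by move=> s; rewrite /dH /H; field; exact: lt0r_neq0.
Qed.

Lemma cauchy_kernel_mul_integral (a b : R) : 0 < a -> 0 < b -> a != b ->
  \int[mu]_t ((t ^+ 2 + a ^+ 2)^-1 * (t ^+ 2 + b ^+ 2)^-1) =
  pi / (a * b * (a + b)).
Proof.
move=> a0 b0 ab.
have [ia Ia] := cauchy_kernel_integral a0.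
have [ib Ib] := cauchy_kernel_integral b0.
have ab2 : b ^+ 2 - a ^+ 2 != 0.
  rewrite subr_sqr mulf_neq0//; first by rewrite subr_eq0 eq_sym.
  by rewrite gt_eqF// addr_gt0.
have posa t : t ^+ 2 + a ^+ 2 != 0 by rewrite gt_eqF// ltr_wpDl ?sqr_ge0// exprn_gt0.
have posb t : t ^+ 2 + b ^+ 2 != 0 by rewrite gt_eqF// ltr_wpDl ?sqr_ge0// exprn_gt0.
have -> : \int[mu]_t ((t ^+ 2 + a ^+ 2)^-1 * (t ^+ 2 + b ^+ 2)^-1) =
  \int[mu]_t ((b ^+ 2 - a ^+ 2)^-1 * ((t ^+ 2 + a ^+ 2)^-1 - (t ^+ 2 + b ^+ 2)^-1)).
  by apply: eq_Rintegral => t _; field; rewrite ab2 posa posb.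
rewrite RintegralZl//; last first.
  by have := integrableB measurableT ia ib; apply: eq_integrable.
rewrite RintegralB// Ia Ib; field.
by rewrite ab2 !gt_eqF// addr_gt0.
Qed.

End FourierIntegrals.

(** * Interchange of integrals against a bounded kernel *)

Section FubiniBounded.
Context {R : realType} d1 d2 (T1 : measurableType d1) (T2 : measurableType d2).

Lemma EFin_Rintegral d (T : measurableType d) (m : {measure set T -> \bar R})
    (f : T -> R) :
  m.-integrable setT (EFin \o f) -> (\int[m]_t f t)%:E = (\int[m]_t (f t)%:E)%E.
Proof. by move=> mf; rewrite /Rintegral fineK//; exact: integrable_fin_num mf. Qed.

Lemma Fubini_bounded (m1 : {sigma_finite_measure set T1 -> \bar R})
    (m2 : {sigma_finite_measure set T2 -> \bar R})
    (g : T1 -> R) (P : T2 -> R) (B : T1 -> T2 -> R) :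
  m1.-integrable setT (EFin \o g) -> m2.-integrable setT (EFin \o P) ->
  measurable_fun setT (fun z : T1 * T2 => B z.1 z.2) ->
  (forall s t, `|B s t| <= 1) ->
  \int[m1]_s ((\int[m2]_t (B s t * P t)) * g s) =
  \int[m2]_t ((\int[m1]_s (B s t * g s)) * P t).
Proof.
move=> ig iP mB B1.
have mg : measurable_fun setT g by case/integrableP : ig => /measurable_EFinP.
have mP : measurable_fun setT P by case/integrableP : iP => /measurable_EFinP.
have mB1 s : measurable_fun setT (B s).
  exact: (measurableT_comp mB (measurable_pair1 s)).
have mB2 t : measurable_fun setT (B ^~ t).
  exact: (measurableT_comp mB (measurable_pair2 t)).
pose f (z : T1 * T2) := (g z.1 * (B z.1 z.2 * P z.2))%:E.
have mf : measurable_fun setT f.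
  apply/measurable_EFinP; apply: measurable_funM.
    exact: (measurableT_comp mg measurable_fst).
  apply: measurable_funM => //.
  exact: (measurableT_comp mP measurable_snd).
have iP1 s : m2.-integrable setT (EFin \o (fun t => B s t * P t)).
  exact: (integrable_bounded_mul (mB1 s) (B1 s) iP).
have ig1 t : m1.-integrable setT (EFin \o (fun s => B s t * g s)).
  exact: (integrable_bounded_mul (mB2 t) (B1 ^~ t) ig).
have iPn := integrable_norm iP.
have ign := integrable_norm ig.
(* Since |B| <= 1, the integrand is dominated by the product of |g| and |P|. *)
have If : (m1 \x m2)%E.-integrable setT f.
  apply/integrable12ltyP => //.
  apply: (@le_lt_trans _ _ (\int[m1]_s ((\int[m2]_t `|P t|) * `|g s|)%:E)%E).
    apply: ge0_le_integral => //.
    - by move=> s _; exact: integral_ge0.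
    - apply: (measurable_fun_fubini_tonelli_F (abse \o f)) => //=.
      exact: measurableT_comp.
    - apply/measurable_EFinP/measurable_funM => //.
      exact: measurableT_comp.
    - move=> s _; rewrite mulrC -RintegralZl// EFin_Rintegral; last first.
        exact: integrable_scale.
      apply: ge0_le_integral => //.
      + apply: measurableT_comp => //; apply/measurable_EFinP.
        apply: (measurable_funM (f := cst (g s))) => //.
        exact: (measurable_funM (mB1 s)).
      + by apply/measurable_EFinP/measurable_funM => //; apply: measurableT_comp.
      + move=> t _; rewrite lee_fin !normrM ler_wpM2l//.
        by rewrite ler_piMl.
  apply: (integrable_lty measurableT).
  exact: integrable_scale.
have := Fubini If.
have -> : (\int[m1]_x \int[m2]_y f (x, y) =
           \int[m1]_s ((\int[m2]_t (B s t * P t)) * g s)%:E)%E.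
  apply: eq_integral => s _; rewrite mulrC -RintegralZl// EFin_Rintegral//.
  exact: integrable_scale.
have -> : (\int[m2]_y \int[m1]_x f (x, y) =
           \int[m2]_t ((\int[m1]_s (B s t * g s)) * P t)%:E)%E.
  apply: eq_integral => t _; rewrite mulrC -RintegralZl// EFin_Rintegral//.
    by apply: eq_integral => s _; rewrite /f/=; congr EFin; ring.
  exact: integrable_scale.
by rewrite /Rintegral => ->.
Qed.

End FubiniBounded.

(** * Fourier transforms obtained from uniqueness of Laplace transforms *)

Section FourierKernels.
Context {R : realType}.
Local Notation mu := (@lebesgue_measure R).

Lemma lebesgue_integrable_bounded_mul (M : R) (h k : R -> R) :
  measurable_fun setT h -> (forall t, `|h t| <= M) ->
  mu.-integrable setT (EFin \o k) ->
  mu.-integrable setT (EFin \o (fun t => h t * k t)).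
Proof. by move=> mh hM ik; apply: (@integrable_bounded_mul _ _ _ _ M) => //; exact: mh. Qed.

Lemma continuous_Rintegral_bounded d (T : measurableType d)
    (m : {measure set T -> \bar R}) (P : T -> R) (B : R -> T -> R) :
  m.-integrable setT (EFin \o P) -> (forall s, measurable_fun setT (B s)) ->
  (forall s t, `|B s t| <= 1) -> (forall t, continuous (B ^~ t)) ->
  continuous (fun s => \int[m]_t (B s t * P t)).
Proof.
move=> iP mB B1 cB s.
have H := @continuity_under_integral _ _ _ m (fun s t => B s t * P t) setT
  measurableT (s - 1) (s + 1) _ _ (fun t => `|P t|).
apply: H.
- by move=> x _; exact: integrable_bounded_mul (mB x) (B1 x) iP.
- apply: aeW => t _ x _; apply: cvgMr_tmp; exact: cB.
- exact: integrable_norm.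
- by move=> x _; apply: aeW => t _; rewrite normrM ler_piMl.
- by rewrite inE/= in_itv/=; apply/andP; split; lra.
Qed.

Lemma le_normr_Rintegral_bounded d (T : measurableType d)
    (m : {measure set T -> \bar R}) (P B : T -> R) :
  m.-integrable setT (EFin \o P) -> measurable_fun setT B ->
  (forall t, `|B t| <= 1) -> `|\int[m]_t (B t * P t)| <= \int[m]_t `|P t|.
Proof.
move=> iP mB B1; have iBP := integrable_bounded_mul mB B1 iP.
rewrite (le_trans (le_normr_Rintegral _ iBP))//.
apply: le_Rintegral => //; [exact: integrable_norm..|].
by move=> t _; rewrite normrM ler_piMl.
Qed.

(* Both sides are even in [s] and have the same Laplace transform at all
   multiples of [c], that is, the same moments in [expR (- c * `|s|)]. *)
Lemma transform_uniqueness (P h T : R -> R) (c M : R) : 0 < c ->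
  mu.-integrable setT (EFin \o P) ->
  continuous h -> (forall x, `|h x| <= 1) ->
  continuous T -> (forall x, 0 <= x -> `|T x| <= M) ->
  (forall n : nat, let a := n.+1%:R * c in
    \int[mu]_t ((\int[mu]_s (h (`|s| * t) * expR (- a * `|s|))) * P t) =
    \int[mu]_s (T `|s| * expR (- a * `|s|))) ->
  forall s : R, \int[mu]_t (h (`|s| * t) * P t) = T `|s|.
Proof.
move=> c0 iP ch h1 cT TM Hn s0.
have cabs : continuous (fun s : R => `|s|) by exact: norm_continuous.
have cTa : continuous (fun s : R => T `|s|).
  by move=> s; apply: continuous_comp; [exact: cabs|exact: cT].
have mh : measurable_fun setT h by exact: continuous_measurable_fun.
have mB : measurable_fun setT (fun z : R * R => h (`|z.1| * z.2)).
  apply: (measurableT_comp mh); apply: measurable_funM => //.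
  apply: (measurableT_comp (f := fun s : R => `|s|)) => //.
have mB1 (s : R) : measurable_fun setT (fun t : R => h (`|s| * t)).
  exact: (measurableT_comp mB (measurable_pair1 s)).
pose phi (s : R) := \int[mu]_t (h (`|s| * t) * P t).
have cphi : continuous phi.
  apply: continuous_Rintegral_bounded => // t s.
  apply: continuous_comp; last exact: ch.
  by apply: cvgMr_tmp; exact: cabs.
have phiM s : `|phi s| <= \int[mu]_t `|P t|.
  by apply: le_normr_Rintegral_bounded => //; exact: mB1.
have ie a : 0 < a -> mu.-integrable setT (EFin \o (fun s => expR (- a * `|s|))).
  by move=> a0; have [] := expR_abs_integral a0.
pose x (s : R) := expR (- c * `|s|).
(* The extra factor [x s] makes [k] integrable, and the n-th moment of [k] in [x] becomes a Laplace
   transform at [n.+1%:R * c]. *)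
pose k s := (phi s - T `|s|) * x s.
have ck : continuous k.
  move=> s; apply: cvgM; last exact: continuous_expR_abs.
  by apply: cvgB; [exact: cphi|exact: cTa].
have mT : measurable_fun setT (fun s : R => T `|s|) by exact: continuous_measurable_fun.
have mphi : measurable_fun setT phi by exact: continuous_measurable_fun.
have bk s : `|phi s - T `|s| | <= \int[mu]_t `|P t| + M.
  by rewrite (le_trans (ler_normB _ _))// lerD// TM.
have ik : mu.-integrable setT (EFin \o k).
  exact: (lebesgue_integrable_bounded_mul (measurable_funB mphi mT) bk (ie _ c0)).
have kE : k s0 = 0.
  apply: (@even_moments_eq0 _ k x) => //.
  - by move=> s; rewrite /k /x /phi normrN.
  - by apply: continuous_measurable_fun; exact: continuous_expR_abs.
  - move=> s; rewrite expR_ge0/= /x -[leRHS]expR0 ler_expR mulNr oppr_le0.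
    by rewrite mulr_ge0// ltW.
  - move=> s t st; rewrite /x ltr_expR !mulNr ltrN2 ltr_pM2l//.
  - exact: continuous_expR_abs.
  - exact: ck.
  - move=> n; pose a := n.+1%:R * c.
    have a0 : 0 < a by rewrite mulr_gt0// ltr0n.
    transitivity (\int[mu]_s (phi s * expR (- a * `|s|) - T `|s| * expR (- a * `|s|))).
      apply: eq_Rintegral => s _; rewrite -mulrBl /k mulrCA; congr (_ * _).
      rewrite /x -exprSr -expRM_natl; congr expR; rewrite /a; ring.
    have i1 := lebesgue_integrable_bounded_mul mphi phiM (ie _ a0).
    have bT (s : R) : `|T `|s| | <= M by exact: TM.
    have i2 := lebesgue_integrable_bounded_mul mT bT (ie _ a0).
    rewrite RintegralB//.
    rewrite (@Fubini_bounded _ _ _ _ _ mu mu _ _ (fun s t => h (`|s| * t)))//; last exact: ie.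
    by rewrite Hn subrr.
move/eqP: kE; rewrite /k mulf_eq0 [X in _ || X]gt_eqF ?expR_gt0// orbF subr_eq0.
by move/eqP.
Qed.

Lemma measurable_cauchy_kernel (a : R) : 0 < a ->
  measurable_fun setT (fun t : R => (t ^+ 2 + a ^+ 2)^-1).
Proof.
move=> a0; apply: measurable_fun_invr => [|t].
  by apply: measurable_funD => //; exact: measurable_funX.
by rewrite ltr_wpDl ?sqr_ge0// exprn_gt0.
Qed.

Lemma integrable_cauchy_kernel_mul (a b : R) : 0 < a -> 0 < b ->
  mu.-integrable setT
    (EFin \o (fun t => (t ^+ 2 + a ^+ 2)^-1 * (t ^+ 2 + b ^+ 2)^-1)).
Proof.
move=> a0 b0; have [ib _] := cauchy_kernel_integral b0.
have a20 : 0 < a ^+ 2 by exact: exprn_gt0.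
apply: (@integrable_bounded_mul _ _ _ _ (a ^+ 2)^-1 _ _ _ _ ib) => [|t].
  exact: measurable_cauchy_kernel.
rewrite ger0_norm ?invr_ge0 ?addr_ge0 ?sqr_ge0//.
by rewrite lef_pV2 ?posrE ?ltr_wpDl ?sqr_ge0// lerDr sqr_ge0.
Qed.

(** Each of the two terms decays only like 1 / t; their difference is (y^2 - 1) t / ((t^2 + 1) (t^2
    + y^2)), a bounded function times the Cauchy kernel. *)
Lemma integrable_conjugate_kernel (y : R) : 0 < y ->
  mu.-integrable setT
    (EFin \o (fun t => t / (t ^+ 2 + 1) - t / (t ^+ 2 + y ^+ 2))).
Proof.
move=> y0; have [iy _] := cauchy_kernel_integral y0.
have py (t : R) : 0 < t ^+ 2 + y ^+ 2 by rewrite ltr_wpDl ?sqr_ge0// exprn_gt0.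
have p1 (t : R) : 0 < t ^+ 2 + 1 by rewrite ltr_wpDl ?sqr_ge0.
pose h t := (y ^+ 2 - 1) * (t * (t ^+ 2 + 1)^-1).
have mh : measurable_fun setT h.
  apply: measurable_funM => //; apply: measurable_funM => //.
  apply: measurable_fun_invr => //.
  by apply: measurable_funD => //; exact: measurable_funX.
have bh t : `|h t| <= `|y ^+ 2 - 1|.
  have ip1 : 0 <= (t ^+ 2 + 1)^-1 by rewrite invr_ge0 ltW.
  rewrite normrM ler_piMr// normrM (ger0_norm ip1).
  rewrite ler_pdivrMr// mul1r -[t ^+ 2]real_normK ?num_real//.
  by have := normr_ge0 t; nra.
have := lebesgue_integrable_bounded_mul mh bh iy; apply: eq_integrable => //.
move=> t _ /=; congr EFin; rewrite /h; field.
by rewrite !lt0r_neq0.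
Qed.

Lemma cauchy_kernel_cos (y s : R) : 0 < y ->
  \int[mu]_t (cos (`|s| * t) * (t ^+ 2 + y ^+ 2)^-1) = pi / y * expR (- y * `|s|).
Proof.
move=> y0.
have [iP IP] := cauchy_kernel_integral y0.
(* Multiples of y + 1 all exceed y, so the partial fractions with [a] and [y] are legitimate. *)
have c0 : 0 < y + 1 by lra.
apply: (@transform_uniqueness _ (@cos R) (fun x => pi / y * expR (- y * x)) _ (pi / y) c0 iP).
- exact: continuous_cos.
- by move=> x; rewrite ler_norml cos_geN1 cos_le1.
- move=> x; apply: cvgMl_tmp; apply: continuous_comp; last exact: continuous_expR.
  by apply: cvgMl_tmp; exact: cvg_id.
- move=> x x0; have p0 : 0 <= pi / y by rewrite divr_ge0 ?pi_ge0 ?ltW.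
  rewrite normrM (ger0_norm p0) (ger0_norm (expR_ge0 _)) ler_piMr//.
  by rewrite -[leRHS]expR0 ler_expR mulNr oppr_le0 mulr_ge0// ltW.
- move=> n a.
  have a0 : 0 < a by rewrite mulr_gt0// ltr0n.
  have ya : y < a.
    have : 1 <= n.+1%:R :> R by rewrite ler1n.
    by rewrite /a; nra.
  transitivity (\int[mu]_t (2 * a * ((t ^+ 2 + a ^+ 2)^-1 * (t ^+ 2 + y ^+ 2)^-1))).
    by apply: eq_Rintegral => t _; rewrite laplace_cos// !mulrA.
  rewrite RintegralZl//; last first.
    exact: integrable_cauchy_kernel_mul.
  rewrite cauchy_kernel_mul_integral ?gt_eqF//.
  transitivity (\int[mu]_t (pi / y * expR (- (y + a) * `|t|))); last first.
    apply: eq_Rintegral => t _; rewrite -[RHS]mulrA -expRD; congr (_ * expR _); ring.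
  have ya0 : 0 < y + a by lra.
  have [ie Ie] := expR_abs_integral ya0.
  rewrite RintegralZl// Ie; field.
  by rewrite !gt_eqF// addr_gt0.
Qed.

Lemma conjugate_kernel_sin (y s : R) : 0 < y ->
  \int[mu]_t (sin (`|s| * t) * (t / (t ^+ 2 + 1) - t / (t ^+ 2 + y ^+ 2))) =
  pi * (expR (- `|s|) - expR (- y * `|s|)).
Proof.
move=> y0.
have py (t : R) : 0 < t ^+ 2 + y ^+ 2 by rewrite ltr_wpDl ?sqr_ge0// exprn_gt0.
have p1 (t : R) : 0 < t ^+ 2 + 1 by rewrite ltr_wpDl ?sqr_ge0.
(* Multiples of y + 2 exceed both y and 1, the two parameters of the conjugate kernel. *)
have c0 : 0 < y + 2 by lra.
have ce (b : R) : continuous (fun x : R => expR (- b * x)).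
  move=> x; apply: continuous_comp; last exact: continuous_expR.
  by apply: cvgMl_tmp; exact: cvg_id.
have e1 b x : 0 < b -> 0 <= x -> `|expR (- b * x)| <= 1.
  move=> b0 x0; rewrite ger0_norm ?expR_ge0//.
  by rewrite -[leRHS]expR0 ler_expR mulNr oppr_le0 mulr_ge0// ltW.
have -> : pi * (expR (- `|s|) - expR (- y * `|s|)) =
    (fun x => pi * (expR (- 1 * x) - expR (- y * x))) `|s|.
  by rewrite /= mulN1r.
apply: (@transform_uniqueness _ (@sin R)
  (fun x => pi * (expR (- 1 * x) - expR (- y * x))) _ (pi * 2) c0
  (integrable_conjugate_kernel y0)).
- exact: continuous_sin.
- by move=> x; rewrite ler_norml sin_geN1 sin_le1.
- move=> x; apply: cvgMl_tmp; apply: cvgB; exact: ce.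
- move=> x x0; rewrite normrM ger0_norm ?pi_ge0// ler_wpM2l ?pi_ge0//.
  by rewrite (le_trans (ler_normB _ _))// (_ : 2 = 1 + 1)// lerD// e1.
- move=> n a.
  have a0 : 0 < a by rewrite mulr_gt0// ltr0n.
  have ya : y + 2 <= a.
    have : 1 <= n.+1%:R :> R by rewrite ler1n.
    by rewrite /a; nra.
  (* The factor t of the sine transform combines with the kernel: t^2 / (t^2 + 1) - t^2 / (t^2 +
     y^2) = y^2 / (t^2 + y^2) - 1 / (t^2 + 1). *)
  transitivity (\int[mu]_t (2 * y ^+ 2 * ((t ^+ 2 + a ^+ 2)^-1 * (t ^+ 2 + y ^+ 2)^-1)
      - 2 * ((t ^+ 2 + a ^+ 2)^-1 * (t ^+ 2 + 1 ^+ 2)^-1))).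
    apply: eq_Rintegral => t _; rewrite laplace_sin//.
    have pa : 0 < t ^+ 2 + a ^+ 2 by rewrite ltr_wpDl ?sqr_ge0// exprn_gt0.
    rewrite expr1n; field.
    by rewrite !lt0r_neq0.
  have i1 := integrable_cauchy_kernel_mul a0 y0.
  have i2 := integrable_cauchy_kernel_mul a0 (@ltr01 R).
  rewrite RintegralB//; [|exact: integrable_scale..].
  rewrite !RintegralZl//.
  rewrite !cauchy_kernel_mul_integral ?gt_eqF//; [|lra..].
  have ya0 : 0 < y + a by lra.
  have a10 : 0 < 1 + a by lra.
  have [iey Iey] := expR_abs_integral ya0.
  have [ie1 Ie1] := expR_abs_integral a10.
  transitivity (\int[mu]_t (pi * (expR (- (1 + a) * `|t|) - expR (- (y + a) * `|t|)))); last first.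
    apply: eq_Rintegral => t _; rewrite -[RHS]mulrA mulrBl -!expRD.
    by congr (_ * (expR _ - expR _)); ring.
  rewrite RintegralZl//; last first.
    by have := integrableB measurableT ie1 iey; apply: eq_integrable.
  rewrite RintegralB// Iey Ie1; field.
  by rewrite !lt0r_neq0//; lra.
Qed.

End FourierKernels.

(** * Bernstein's theorem for bounded completely monotonic functions *)

Section TaylorCM.
Context {R : realType}.

Lemma le_of_derive_le0 (f df : R -> R) (a b : R) : a <= b ->
  (forall x, a <= x <= b -> is_derive x 1 f (df x)) ->
  (forall x, a <= x <= b -> df x <= 0) -> f b <= f a.
Proof.
move=> ab fd df0; move: ab; rewrite le_eqVlt => /predU1P[->//|ab].
have [||c cab] := @MVT _ f df a b ab _ _.
- by move=> x; rewrite in_itv/= => /andP[xa xb]; apply: fd; rewrite !ltW.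
- apply: derivable_within_continuous => x; rewrite in_itv/= => xab.
  exact/ex_derive/fd.
rewrite -subr_le0 => ->; rewrite mulr_le0_ge0 ?subr_ge0 ?(ltW ab)//.
by apply: df0; move: cab; rewrite in_itv/= => /andP[ca cb]; rewrite !ltW.
Qed.

Lemma is_derive_exprS (f : R -> R) (df x : R) n : is_derive x 1 f df ->
  is_derive x 1 (fun y => f y ^+ n.+1) (n.+1%:R * f x ^+ n * df).
Proof.
move=> fd; elim: n => [|n IH].
  by under eq_fun do rewrite expr1; rewrite expr0 !mul1r.
under eq_fun do rewrite exprS.
apply: (is_derive_eq (is_derive_mul fd IH)).
by rewrite -[n.+2%:R]natr1 !exprS; ring.
Qed.

Lemma is_derive_continuous (f : R -> R) (df x : R) :
  is_derive x 1 f df -> {for x, continuous f}.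
Proof.
by move=> fd; apply: differentiable_continuous; apply/derivable1_diffP; exact: ex_derive.
Qed.

Lemma le_at_right0 (g : R -> R) (c y0 : R) : {for 0, continuous g} -> 0 < y0 ->
  (forall y, 0 < y < y0 -> g y <= c) -> g 0 <= c.
Proof.
move=> cg y00 H; rewrite leNgt; apply/negP => cg0.
have e0 : 0 < g 0 - c by rewrite subr_gt0.
have /cvgrPdist_lt/(_ _ e0)/nbhs_ballP[d /= d0 gd] := cg.
pose y := Num.min d y0 / 2.
have y1 : 0 < y by rewrite divr_gt0// lt_min d0.
have yd : y < d by rewrite ltr_pdivrMr// gt_min; apply/orP; left; lra.
have yy : y < y0 by rewrite ltr_pdivrMr// gt_min; apply/orP; right; lra.
have := gd y; rewrite /ball/= sub0r normrN gtr0_norm// => /(_ yd).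
have := H y; rewrite y1 yy => /(_ isT).
by rewrite ltr_norml => ? /andP[_ ?]; lra.
Qed.

(* [E n] stands for (-1)^n times the n-th derivative of a completely monotonic
   function. *)
Variables (E : nat -> R -> R).
Hypothesis dE : forall n (y : R), 0 < y -> is_derive y 1 (E n) (- E n.+1 y).
Hypothesis E0 : forall n y, 0 < y -> 0 <= E n y.

(** [T l k N] is the Taylor polynomial of [E k] at [l] with N terms and [D l k N] its remainder; the
    signs in [E] are absorbed by the powers of l - y. Differentiating either one raises k, lowers N
    and changes the sign. *)
Let T (l : R) k N y := \sum_(n < N) E (k + n) l / n`!%:R * (l - y) ^+ n.
Let D (l : R) k N y := E k y - T l k N y.

Let is_derive_sub (l y : R) : is_derive y 1 (fun y => l - y) (-1).
Proof.
by apply: (is_derive_eq (is_deriveB (is_derive_cst l y 1) (is_derive_id y 1))); rewrite sub0r.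
Qed.

Let dT (l : R) k N (y : R) : is_derive y 1 (T l k N.+1) (- T l k.+1 N y).
Proof.
elim: N => [|N IH].
  have -> : T l k 1 = cst (E k l).
    by apply/funext => z; rewrite /T big_ord1 addn0 fact0 divr1 expr0 mulr1.
  rewrite /T big_ord0 oppr0; exact: is_derive_cst.
have -> : T l k N.+2 = fun z => T l k N.+1 z + E (k + N.+1) l / N.+1`!%:R * (l - z) ^+ N.+1.
  by apply/funext => z; rewrite {1}/T big_ord_recr.
have dX := is_derive_exprS N (is_derive_sub l y).
apply: (is_derive_eq (is_deriveD IH (is_deriveZ (E (k + N.+1) l / N.+1`!%:R) dX))).
rewrite /T [in RHS]big_ord_recr/= opprD; congr (_ + _).
rewrite /GRing.scale/= addSnnS factS natrM; field.
by rewrite nat1r !pnatr_eq0 -lt0n fact_gt0.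
Qed.

Let dD (l : R) k N (y : R) : 0 < y -> is_derive y 1 (D l k N.+1) (- D l k.+1 N y).
Proof.
move=> y0; apply: (is_derive_eq (is_deriveB (dE k y0) (dT l k N y))).
by rewrite /D opprB opprK addrC.
Qed.

Let D_diag (l : R) k N : D l k N.+1 l = 0.
Proof.
rewrite /D /T big_ord_recl/= addn0 fact0 divr1 expr0 mulr1 big1 ?addr0 ?subrr//.
by move=> i _; rewrite expr0n mulr0.
Qed.

(** The derivative of the remainder is minus a remainder of lower order, nonnegative by induction;
    so the remainder is nonincreasing, and it vanishes at l. *)
Let D_ge0 (l : R) k N y : 0 < y <= l -> 0 <= D l k N y.
Proof.
elim: N k y => [|N IH] k y /andP[y0 yl].
  by rewrite /D /T big_ord0 subr0 E0.
rewrite -(D_diag l k N).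
apply: (@le_of_derive_le0 _ (fun x => - D l k.+1 N x)) => //.
- by move=> x /andP[yx xl]; apply: dD; exact: lt_le_trans yx.
- by move=> x /andP[yx xl]; rewrite oppr_le0 IH// (lt_le_trans y0 yx).
Qed.

(** The difference of the two sides vanishes at l, and its derivative is the same difference, with
    opposite sign, one order lower. This is the differential inequality behind [D_ratio]. *)
Let D_log_derivative (l : R) k N y : 0 < y <= l ->
  N.+1%:R * D l k N.+1 y <= (l - y) * D l k.+1 N y.
Proof.
elim: N k y => [|N IH] k y /andP[y0 yl].
  rewrite mul1r -subr_ge0.
  pose g z := (l - z) * E k.+1 z - D l k 1 z.
  have -> : (l - y) * D l k.+1 0 y - D l k 1 y = g y.
    by rewrite /g; congr (_ * _ - _); rewrite /D /T big_ord0 subr0.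
  have -> : 0 = g l by rewrite /g D_diag subrr mul0r subrr.
  apply: (@le_of_derive_le0 _ (fun x => - ((l - x) * E k.+2 x))) => //.
  + move=> x /andP[yx xl]; have x0 : 0 < x by exact: lt_le_trans yx.
    apply: (is_derive_eq (is_deriveB (is_derive_mul (is_derive_sub l x) (dE k.+1 x0)) (dD l k 0 x0))).
    by rewrite /D /T big_ord0 subr0; ring.
  + move=> x /andP[yx xl]; have x0 : 0 < x by exact: lt_le_trans yx.
    by rewrite oppr_le0 mulr_ge0 ?subr_ge0 ?E0.
rewrite -subr_ge0.
pose g z := (l - z) * D l k.+1 N.+1 z - N.+2%:R * D l k N.+2 z.
rewrite -/(g y).
have -> : 0 = g l by rewrite /g !D_diag !mulr0 subrr.
apply: (@le_of_derive_le0 _ (fun x => N.+1%:R * D l k.+1 N.+1 x - (l - x) * D l k.+2 N x)) => //.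
+ move=> x /andP[yx xl]; have x0 : 0 < x by exact: lt_le_trans yx.
  apply: (is_derive_eq (is_deriveB (is_derive_mul (is_derive_sub l x) (dD l k.+1 N x0)) (is_deriveZ N.+2%:R (dD l k N.+1 x0)))).
  by rewrite /GRing.scale/= -[N.+2%:R]natr1; ring.
+ move=> x /andP[yx xl]; have x0 : 0 < x by exact: lt_le_trans yx.
  by rewrite subr_le0 IH// x0.
Qed.

(** By [D_log_derivative], the quotient of the remainder by (l - y)^(N+1) has a nonpositive
    derivative. *)
Let D_ratio (l : R) N y' y : 0 < y' -> y' <= y -> y < l ->
  D l 0 N.+1 y * (l - y') ^+ N.+1 <= D l 0 N.+1 y' * (l - y) ^+ N.+1.
Proof.
move=> y'0 y'y yl.
have p z : z <= y -> 0 < (l - z) ^+ N.+1.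
  by move=> zy; rewrite exprn_gt0// subr_gt0 (le_lt_trans zy).
suff : D l 0 N.+1 y * (l - y)^-1 ^+ N.+1 <= D l 0 N.+1 y' * (l - y')^-1 ^+ N.+1.
  by rewrite !exprVn ler_pdivlMr ?p// mulrAC ler_pdivrMr ?p.
pose df x := - ((l - x)^-1 ^+ N.+2 * ((l - x) * D l 1 N x - N.+1%:R * D l 0 N.+1 x)).
apply: (@le_of_derive_le0 (fun x => D l 0 N.+1 x * (l - x)^-1 ^+ N.+1) df) => //.
- move=> x /andP[yx xy]; have x0 : 0 < x by exact: lt_le_trans yx.
  have lx : l - x != 0 by rewrite subr_eq0 gt_eqF// (le_lt_trans xy).
  have dV := is_derive_exprS N (@is_deriveV _ (fun z => l - z) _ _ _ lx (is_derive_sub l x)).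
  apply: (is_derive_eq (is_derive_mul (dD l 0 N x0) dV)).
  rewrite /df /GRing.scale/= !exprS; set a := (l - x)^-1 ^+ N; field; exact: lx.
- move=> x /andP[yx xy]; have x0 : 0 < x by exact: lt_le_trans yx.
  have xl : x < l by exact: le_lt_trans yl.
  rewrite oppr_le0 mulr_ge0 ?exprn_ge0 ?invr_ge0 ?subr_ge0 ?(ltW xl)//.
  by apply: D_log_derivative; rewrite x0 ltW.
Qed.

Variable C : R.
Hypothesis EC : forall y, 0 < y -> E 0 y <= C.

Lemma taylor_CM_remainder_ge0 (l : R) N y : 0 < y < l ->
  \sum_(n < N) E n l / n`!%:R * (l - y) ^+ n <= E 0 y.
Proof.
by move=> /andP[y0 yl]; rewrite -subr_ge0; apply: (D_ge0 0); rewrite y0 ltW.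
Qed.

(** The quotient of the remainder by (l - z)^(N+1) is nonincreasing in z and the remainder at z is
    at most E 0 z <= C; let z tend to 0 from the right. *)
Lemma taylor_CM_remainder_le (l : R) N y : 0 < y < l ->
  E 0 y - \sum_(n < N.+1) E n l / n`!%:R * (l - y) ^+ n <= C * (1 - y / l) ^+ N.+1.
Proof.
move=> /andP[y0 yl]; have l0 : 0 < l by exact: lt_trans yl.
rewrite -[leLHS]/(D l 0 N.+1 y).
have -> : 1 - y / l = (l - y) / l by field; exact: lt0r_neq0.
rewrite expr_div_n mulrA ler_pdivlMr ?exprn_gt0//.
have ly : 0 <= (l - y) ^+ N.+1 by rewrite exprn_ge0// subr_ge0 ltW.
have := @le_at_right0 (fun z => D l 0 N.+1 y * (l - z) ^+ N.+1) (C * (l - y) ^+ N.+1) y.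
rewrite /= subr0; apply => //.
  exact: (is_derive_continuous (is_deriveZ (D l 0 N.+1 y)
    (is_derive_exprS N (is_derive_sub l 0)))).
move=> z /andP[z0 zy]; rewrite (le_trans (D_ratio N z0 (ltW zy) yl))// ler_wpM2r//.
rewrite (le_trans _ (EC z0))// /D lerBlDr lerDl sumr_ge0// => i _.
rewrite mulr_ge0 ?exprn_ge0 ?subr_ge0 ?divr_ge0 ?E0//.
by rewrite (le_trans (ltW zy) (ltW yl)).
Qed.

(** At y > 0 the Taylor sum is at most E 0 y <= C; being a polynomial in y, it keeps this bound at y
    = 0. The total mass of the discretized measures is thus bounded independently of l and N. *)
Lemma taylor_CM_weights_le (l : R) N : 0 < l ->
  \sum_(n < N) E n l / n`!%:R * l ^+ n <= C.
Proof.
case: N => [l0|N l0]; first by rewrite big_ord0 (le_trans (E0 0 l0) (EC l0)).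
have := @le_at_right0 (fun y => \sum_(n < N.+1) E n l / n`!%:R * (l - y) ^+ n) C l.
rewrite /= subr0; apply => //; last first.
  move=> y /andP[y0 yl]; rewrite (le_trans (taylor_CM_remainder_ge0 _ _)) ?EC//.
  by rewrite y0.
exact: is_derive_continuous (dT l 0 N 0).
Qed.

End TaylorCM.

(** * Quantile functions of discrete measures *)

Section Quantile.
Context {R : realType}.
Local Notation mu := (@lebesgue_measure R).

(* With [S] the partial sums of weights [p n] placed at a nonincreasing sequence
   [x n], this is the quantile function of the first [N] weights; the values
   outside [[0, S N[] only serve to keep it monotone on the whole line. *)
Fixpoint step_fun (S x : nat -> R) N (u : R) : R :=
  if N is N'.+1 then
    if u < S N' then step_fun S x N' u else if u < S N then x N' else 0
  else if u < 0 then 1 else 0.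

Variables p x : nat -> R.
Hypothesis p0 : forall n, 0 <= p n.
Hypothesis x01 : forall n, 0 <= x n <= 1.
Hypothesis xdec : forall n, x n.+1 <= x n.
Let S n := \sum_(i < n) p i.
Local Notation step := (step_fun S x).

Let S_mono n : S n <= S n.+1.
Proof. by rewrite /S big_ord_recr/= lerDl. Qed.

(** The second clause carries the induction for monotonicity: before [S N] the values are at least
    [x N], which is the value of the next step. *)
Lemma step_fun_props N :
  [/\ forall u, S N <= u -> step N u = 0,
      forall u, u < S N -> x N <= step N u,
      {homo step N : u v /~ u <= v} & forall u, 0 <= step N u <= 1].
Proof.
elim: N => [|N [H1 H2 H3 H4]].
  rewrite /S big_ord0; split=> [u|u|u v|u] /=.
  - by rewrite leNgt => /negbTE ->.
  - by move=> ->; have /andP[] := x01 0.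
  - move=> uv; case: ltP => u0; case: ltP => v0 //.
    by have := lt_le_trans u0 v0; rewrite ltNge uv.
  - by case: ltP => _; rewrite lexx ler01.
have /andP[xN0 xN1] := x01 N; have /andP[xS0 xS1] := x01 N.+1.
split=> [u Su|u Su|v u uv|u] /=.
- have SNu := le_trans (S_mono N) Su.
  by rewrite ltNge SNu/= ltNge Su.
- rewrite Su; case: ltP => // uN.
  by rewrite (le_trans (xdec N))// H2.
- case: (ltP v (S N)) => vN; first by rewrite (le_lt_trans uv vN) H3.
  case: (ltP v _) => vN1; case: (ltP u (S N)) => uN.
  + exact: H2.
  + by rewrite (le_lt_trans uv vN1).
  + by have /andP[] := H4 u.
  + by case: ltP.
- by case: ltP => // _; case: ltP => // _; rewrite ?lexx ?ler01 ?xN0.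
Qed.

(** The N-th step replaces the value 0 by [x N] on an interval of length [p N]; since phi 0 = 0,
    this adds exactly [phi (x N) * p N], and the rest of [0, C] contributes nothing. *)
Lemma step_fun_integral (phi : R -> R) N (C : R) : phi 0 = 0 -> S N <= C ->
  mu.-integrable `[0, C] (EFin \o (phi \o step N)) /\
  \int[mu]_(u in `[0, C]) phi (step N u) = \sum_(n < N) phi (x n) * p n.
Proof.
move=> phi0; elim: N => [|N IH] SC.
  have E u : u \in `[0, C]%classic -> phi (step 0 u) = 0.
    by rewrite inE/= in_itv/= => /andP[u0 _]; rewrite ltNge u0.
  split.
    apply: (eq_integrable _ (cst 0%E)) => //; last exact: integrable0.
    by move=> u uC; rewrite /= E.
  rewrite big_ord0 (@eq_Rintegral _ _ _ _ _ (cst 0))//.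
  by rewrite Rintegral_cst// mul0r.
have [I1 I2] := IH (le_trans (S_mono N) SC).
have [Hz _ _ _] := step_fun_props N.
have S0 : 0 <= S N by apply: sumr_ge0.
pose A : set R := `[S N, S N.+1[%classic.
have E u : phi (step N.+1 u) = phi (step N u) + phi (x N) * \1_A u.
  rewrite /= indicE; case: ltP => uN.
    rewrite memNset ?mulr0 ?addr0// /A/= in_itv/=.
    by apply/negP; rewrite negb_and -ltNge uN.
  rewrite (Hz _ uN) phi0 add0r; case: ltP => uN1.
    by rewrite mem_set ?mulr1// /A/= in_itv/= uN uN1.
  rewrite memNset ?mulr0// /A/= in_itv/=.
  by apply/negP; rewrite negb_and -leNgt uN1 orbT.
have iA : mu.-integrable `[0, C] (EFin \o (\1_A : R -> R)).
  apply: (integrableS measurableT) => //.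
  exact: integrable_indic_itv.
have iZ : mu.-integrable `[0, C] (EFin \o (fun u => phi (x N) * \1_A u)).
  have iZ0 : mu.-integrable `[0, C]
      (fun u => ((phi (x N))%:E * (EFin \o (\1_A : R -> R)) u)%E).
    exact: integrableZl.
  by move: iZ0; apply: eq_integrable.
split.
  have iD : mu.-integrable `[0, C] ((EFin \o (phi \o step N)) \+
      (EFin \o (fun u : R => (phi (x N) * \1_A u)%R)))%E.
    exact: integrableD.
  by move: iD; apply: eq_integrable => // u _; rewrite /= -EFinD -E.
under eq_Rintegral do rewrite E.
rewrite RintegralD// I2 big_ord_recr/= RintegralZl//; congr (_ + _ * _).
rewrite /Rintegral integral_indic//; last exact: measurable_itv.
have -> : (A `&` `[0, C]%classic) = A.
  apply/setIidPl => u; rewrite /A/= !in_itv/= => /andP[u1 u2].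
  by rewrite (le_trans S0 u1) (le_trans (ltW u2) SC).
have muA : mu A = (p N)%:E.
  rewrite /A lebesgue_measure_itv/= lte_fin.
  have SE : S N.+1 = S N + p N by rewrite /S big_ord_recr.
  rewrite -EFinB SE addrAC subrr add0r ltrDl; case: ltP => // pN.
  by congr EFin; apply/eqP; rewrite eq_le p0.
by rewrite [X in fine X]muA.
Qed.

End Quantile.

(** * Riemann sums of monotone functions *)

Section MonotoneRiemann.
Context {R : realType}.
Local Notation mu := (@lebesgue_measure R).
Variable g : R -> R.
Hypothesis gdec : {homo g : u v /~ u <= v}.
Hypothesis g01 : forall u, 0 <= g u <= 1.

Lemma monotone_integrable (a b : R) : mu.-integrable `[a, b] (EFin \o g).
Proof.
have mab : (mu `[a, b]%classic < +oo)%E.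
  by rewrite lebesgue_measure_itv/=; case: ifP => // _; rewrite -EFinB ltry.
apply: measurable_bounded_integrable => //.
- by apply: nonincreasing_measurable => // u v uv; exact: gdec.
- exists 1; split=> // M M1 u _ /=.
  by have /andP[? ?] := g01 u; rewrite ger0_norm// (le_trans _ (ltW M1)).
Qed.

Lemma monotone_riemann (h : R) m : 0 <= h ->
  h * \sum_(k < m) g (k.+1%:R * h) <= \int[mu]_(u in `[0, m%:R * h]) g u
    <= h * \sum_(k < m) g (k%:R * h).
Proof.
move=> h0; elim: m => [|m /andP[IH1 IH2]].
  by rewrite !big_ord0 mulr0 mul0r set_itv1 Rintegral_set1 lexx.
have mh : m%:R * h <= m.+1%:R * h by rewrite ler_wpM2r// ler_nat.
have := Rintegral_itvB (monotone_integrable 0 (m.+1%:R * h)) (x := m%:R * h).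
rewrite !bnd_simp mulr_ge0// => /(_ isT mh) H.
have ig : mu.-integrable `]m%:R * h, m.+1%:R * h] (EFin \o g).
  apply: (integrableS _ _ _ (monotone_integrable (m%:R * h) (m.+1%:R * h))) => //.
  exact: subset_itv_oc_cc.
have mI : mu `]m%:R * h, m.+1%:R * h] = h%:E.
  rewrite lebesgue_measure_itv/= lte_fin -EFinB -mulrBl -natr1 addrAC subrr add0r mul1r.
  move: h0; rewrite le_eqVlt => /predU1P[<-|h1]; first by rewrite !mulr0 ltxx.
  by rewrite ltr_pM2r// ltrDl ltr01.
have ic (c : R) : mu.-integrable `]m%:R * h, m.+1%:R * h] (EFin \o cst c).
  apply: measurable_bounded_integrable => //.
  - by rewrite [ltLHS]mI ltry.
  - by exists `|c|; split=> // M M1 u _ /=; exact: ltW.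
have c1 : h * g (m.+1%:R * h) <= \int[mu]_(u in `]m%:R * h, m.+1%:R * h]) g u.
  rewrite mulrC -[X in _ * X]/(fine h%:E) -mI -Rintegral_cst//.
  apply: le_Rintegral => //; [exact: ic|move=> u]; rewrite /= in_itv/= => /andP[_ u2]; exact: gdec.
have c2 : \int[mu]_(u in `]m%:R * h, m.+1%:R * h]) g u <= h * g (m%:R * h).
  rewrite [leRHS]mulrC -[X in _ <= _ * X]/(fine h%:E) -mI -Rintegral_cst//.
  apply: le_Rintegral => //; [exact: ic|move=> u]; rewrite /= in_itv/= => /andP[u1 _]; exact/gdec/ltW.
rewrite !big_ord_recr/= !mulrDr; move: H => /eqP; rewrite subr_eq => /eqP ->.
by apply/andP; split; [rewrite [leRHS]addrC lerD|rewrite addrC lerD].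
Qed.

(** Upper and lower sums differ by a telescoping term, at most one mesh. The bound is the same for
    all monotone functions with values in [0, 1], which allows a limit to be taken under the
    integral. *)
Lemma monotone_riemann_dist (C : R) m : 0 <= C ->
  `|\int[mu]_(u in `[0, C]) g u -
    C / m.+1%:R * \sum_(k < m.+1) g (k%:R * (C / m.+1%:R))| <= C / m.+1%:R.
Proof.
move=> C0; set h := C / m.+1%:R.
have h0 : 0 <= h by rewrite divr_ge0.
have Ch : C = m.+1%:R * h by rewrite /h mulrCA divff ?mulr1// pnatr_eq0.
rewrite {1}Ch; have /andP[H1 H2] := monotone_riemann m.+1 h0.
have H3 : \sum_(k < m.+1) g (k%:R * h) <= \sum_(k < m.+1) g (k.+1%:R * h) + 1.
  rewrite big_ord_recl/= [X in _ <= X + _]big_ord_recr/= mul0r.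
  under eq_bigr do rewrite /bump/= add1n.
  by have /andP[_ ?] := g01 0; have /andP[? _] := g01 (m.+1%:R * h); lra.
rewrite ler_norml; apply/andP; split; last by lra.
by have := ler_wpM2l h0 H3; rewrite mulrDr mulr1; lra.
Qed.

End MonotoneRiemann.

(** By compactness the image filter has a cluster point in [0, 1], and a cluster point of an
    ultrafilter is a limit. *)
Lemma ultra_cvg01 {R : realType} (U : set_system nat) (a : nat -> R) :
  UltraFilter U -> (forall n, 0 <= a n <= 1) ->
  exists2 l : R, 0 <= l <= 1 & a @ U --> l.
Proof.
move=> UU a01.
have UP : ProperFilter U by exact: ultra_proper.
have [l [l01 cl]] := @segment_compact R 0 1 (a @ U) _
  (filterS (fun n _ => a01 n) filterT).
exists l; first by move: l01; rewrite /= in_itv.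
move=> B nB; have [//|UnB] := in_ultra_setVsetC (a @^-1` B) UU.
by have [z []] := cl (~` B) B UnB nB.
Qed.

Lemma cvg_powR {R : realType} T (F : set_system T) (FF : Filter F) (a : T -> R) (l y : R) :
  0 < y -> (forall n, 0 <= a n) -> 0 <= l -> a @ F --> l ->
  (fun n => a n `^ y) @ F --> l `^ y.
Proof.
move=> y0 a0; rewrite le_eqVlt => /predU1P[<-|l0] al.
  (* The power is differentiable only at positive points, so the limit 0 is treated by hand. *)
  rewrite powR0 ?gt_eqF//; apply/cvgrPdist_lt => e e0.
  have d0 : 0 < e `^ y^-1 by rewrite powR_gt0.
  move/cvgrPdist_lt : al => /(_ _ d0); apply: filterS => n.
  rewrite !sub0r !normrN ger0_norm// => aN; rewrite ger0_norm ?powR_ge0//.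
  have -> : e = (e `^ y^-1) `^ y.
    by rewrite -powRrM mulVf ?gt_eqF// powRr1// ltW.
  by rewrite gt0_ltr_powR// ?nnegrE// ltW.
have cl : {for l, continuous (fun z : R => z `^ y)}.
  apply: differentiable_continuous; apply/derivable1_diffP.
  by apply: derivable_powR; rewrite in_itv/= l0.
exact: (cvg_comp _ _ al cl).
Qed.

(** * Construction of the representing measure *)

Section Bernstein.
Context {R : realType}.
Local Notation mu := (@lebesgue_measure R).

Lemma cvg_sum_ord T (F : set_system T) (FF : Filter F) m (a : nat -> T -> R) (l : nat -> R) :
  (forall k, a k @ F --> l k) ->
  (fun t => \sum_(k < m) a k t) @ F --> \sum_(k < m) l k.
Proof.
move=> al; elim: m => [|m IH].
  rewrite big_ord0 (_ : (fun t => _) = cst 0); first exact: cvg_cst.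
  by apply/funext => t; rewrite big_ord0.
rewrite big_ord_recr/= (_ : (fun t => _) =
  (fun t => \sum_(k < m) a k t) \+ a m); first exact: cvgD.
by apply/funext => t; rewrite big_ord_recr.
Qed.

Lemma Rintegral_mfrestr d (T : measurableType d) (m : {measure set T -> \bar R})
    (D : set T) (mD : measurable D) (moo : (m D < +oo)%E) (f : T -> R) :
  (mfrestr mD moo).-integrable setT (EFin \o f) ->
  \int[mfrestr mD moo]_u f u = \int[m]_(u in D) f u.
Proof.
move=> fi; rewrite /Rintegral; congr fine.
rewrite (negligible_integral (measurableC mD) measurableT fi); last first.
  by rewrite /= /mfrestr /mrestr setICl measure0.
rewrite setTD setCK; apply: eq_measure_integral => A mA AD.
by rewrite /= /mfrestr /mrestr setIidl.
Qed.

Lemma finite_integrable_bounded d (T : measurableType d)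
    (P : {finite_measure set T -> \bar R}) (M : R) (f : T -> R) :
  measurable_fun setT f -> (forall u, `|f u| <= M) ->
  P.-integrable setT (EFin \o f).
Proof.
move=> mf fM.
have i1 : P.-integrable setT (EFin \o (cst 1 : T -> R)).
  exact: finite_measure_integrable_cst.
have := integrable_bounded_mul mf fM i1.
by apply: eq_integrable => // u _; rewrite /= mulr1.
Qed.

Variables (E : nat -> R -> R) (C : R).
Hypothesis dE : forall n (y : R), 0 < y -> is_derive y 1 (E n) (- E n.+1 y).
Hypothesis E0 : forall n y, 0 < y -> 0 <= E n y.
Hypothesis EC : forall y, 0 < y -> E 0 y <= C.
Hypothesis C0 : 0 < C.

(* By Taylor expansion at [l j], [E 0 y] is approximately the sum of the terms
   [(1 - y / l j)^n * p j n], in which [(1 - y / l j)^n] is close to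
   [x j n `^ y]; the quadratic length [N j] makes the remainder tend to 0. *)
Let l (j : nat) : R := j.+1%:R.
Let p j n := E n (l j) / n`!%:R * l j ^+ n.
Let x (j n : nat) := expR (- n%:R / l j).
Let N j := (j.+1 * j.+1)%N.
Let X j := step_fun (fun n => \sum_(i < n) p j i) (x j) (N j).
Let I j y := \sum_(n < N j) x j n `^ y * p j n.

Let l0 j : 0 < l j. Proof. by rewrite ltr0n. Qed.

Let p0 j n : 0 <= p j n.
Proof. by rewrite mulr_ge0 ?divr_ge0 ?E0// exprn_ge0. Qed.

Let x01 j n : 0 <= x j n <= 1.
Proof.
by rewrite expR_ge0/= -[leRHS]expR0 ler_expR mulNr oppr_le0 divr_ge0.
Qed.

Let xdec j n : x j n.+1 <= x j n.
Proof. by rewrite ler_expR ler_pM2r ?invr_gt0// lerN2 ler_nat. Qed.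

Let Xdec j : {homo X j : u v /~ u <= v}.
Proof. by have [] := step_fun_props (p0 j) (x01 j) (xdec j) (N j). Qed.

Let X01 j u : 0 <= X j u <= 1.
Proof. by have [_ _ _ H] := step_fun_props (p0 j) (x01 j) (xdec j) (N j); exact: H. Qed.

Let X_integral j y : 0 < y -> \int[mu]_(u in `[0, C]) X j u `^ y = I j y.
Proof.
move=> y0.
have H := step_fun_integral (p0 j) (x01 j) (xdec j) (phi := fun z => z `^ y).
have [||//] := H (N j) C; first by rewrite powR0// gt_eqF.
exact: (taylor_CM_weights_le dE E0 EC).
Qed.

(** The point at which 1 - z / l j equals exp(-y / l j): its n-th power is then the power y of
    [x j n], so the Taylor sum at [z j y] is exactly [I j y]. *)
Let z j y := l j * (1 - expR (- y / l j)).

Let z_bounds j y : 0 < y -> 0 < z j y < l j /\ `|y - z j y| <= y ^+ 2 * harmonic j.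
Proof.
move=> y0; set t := y / l j.
have t0 : 0 < t by rewrite divr_gt0.
have ylt : y = l j * t by rewrite /t mulrCA divff ?mulr1// gt_eqF.
have zE : z j y = l j * (1 - expR (- t)) by rewrite /z mulNr.
have e1 : expR (- t) < 1 by rewrite expR_lt1 oppr_lt0.
(* Together these bounds give 0 <= t - (1 - exp(-t)) <= t^2, hence a distance of at most l j * t^2 =
   y^2 / l j. *)
have e2 : 1 - t <= expR (- t) by rewrite expR_ge1Dx.
have e3 : expR (- t) <= (1 + t)^-1.
  by rewrite expRN lef_pV2 ?posrE ?expR_gt0 ?expR_ge1Dx//; lra.
have e4 : (1 + t)^-1 <= 1 - t + t ^+ 2.
  have t1 : 0 < 1 + t by lra.
  rewrite -[leLHS]mul1r ler_pdivrMr//; nra.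
split.
  rewrite zE mulr_gt0 ?subr_gt0//=.
  by rewrite gtr_pMr// ltrBlDr ltrDl expR_gt0.
have -> : harmonic j = (l j)^-1 by [].
have -> : y ^+ 2 * (l j)^-1 = l j * t ^+ 2.
  by rewrite ylt; field; rewrite gt_eqF.
rewrite zE [X in X - _]ylt -mulrBr normrM (gtr0_norm (l0 j)) ler_wpM2l ?(ltW (l0 j))//.
by rewrite ler_norml; apply/andP; split; lra.
Qed.

Let I_dist j y : 0 < y -> `|E 0 (z j y) - I j y| <= C * y^-1 * harmonic j.
Proof.
move=> y0; have [zl _] := z_bounds j y0.
have -> : I j y = \sum_(n < N j) E n (l j) / n`!%:R * (l j - z j y) ^+ n.
  apply: eq_bigr => n _; rewrite /x /p -expRM.
  have -> : l j - z j y = l j * expR (- y / l j) by rewrite /z; ring.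
  rewrite exprMn -expRM_natl.
  have -> : - n%:R / l j * y = n%:R * (- y / l j) by ring.
  by ring.
have := taylor_CM_remainder_ge0 dE E0 (N j) zl.
have := taylor_CM_remainder_le dE E0 EC (j.+1 * j.+1).-1 zl.
rewrite -[(j.+1 * j.+1).-1.+1]/(N j).
have -> : 1 - z j y / l j = expR (- y / l j) by rewrite /z; field; rewrite gt_eqF.
rewrite -expRM_natl.
(* Because [N j] is the square of [l j], the remainder factor is exp(-y l j), which is at most 1 /
   (y l j). *)
have -> : (N j)%:R * (- y / l j) = - y * l j.
  by rewrite /N natrM -/(l j); field; rewrite gt_eqF.
move=> H1 H2; rewrite ger0_norm ?subr_ge0// (le_trans H1)// -mulrA ler_wpM2l ?(ltW C0)//.
have yl0 : 0 < y * l j by rewrite mulr_gt0.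
rewrite [harmonic j]/((l j)^-1) -invfM mulNr expRN lef_pV2 ?posrE ?expR_gt0//.
by rewrite (le_trans _ (expR_ge1Dx _))// lerDr.
Qed.

Let I_cvg y : 0 < y -> I ^~ y @ \oo --> E 0 y.
Proof.
move=> y0.
have zc : z ^~ y @ \oo --> y.
  have hc : (fun j => y ^+ 2 * harmonic j) @ \oo --> (0 : R).
    by rewrite -[X in _ --> X](mulr0 (y ^+ 2)); apply: cvgMl_tmp; exact: cvg_harmonic.
  apply/cvgrPdist_lt => e e0; move/cvgrPdist_lt : hc => /(_ _ e0).
  apply: filterS => j; rewrite sub0r normrN => H.
  have [_ H2] := z_bounds j y0.
  by rewrite (le_lt_trans H2)// (le_lt_trans (ler_norm _)).
have Ec : (fun j => E 0 (z j y)) @ \oo --> E 0 y.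
  exact: (cvg_comp _ _ zc (is_derive_continuous (dE 0 y0))).
have ec : (fun j => C * y^-1 * harmonic j) @ \oo --> (0 : R).
  by rewrite -[X in _ --> X](mulr0 (C * y^-1)); apply: cvgMl_tmp; exact: cvg_harmonic.
have dc : (fun j => E 0 (z j y) - I j y) @ \oo --> (0 : R).
  apply: norm_cvg0; apply: (squeeze_cvgr (f := cst 0) _ (cvg_cst _) ec).
  by apply: nearW => j /=; rewrite normr_ge0 I_dist.
rewrite -[X in _ --> X]subr0.
have -> : I ^~ y = (fun j => E 0 (z j y) - (E 0 (z j y) - I j y)).
  by apply/funext => j; ring.
exact: cvgB.
Qed.

(** A selection argument in the style of Helly: along an ultrafilter finer than [\oo], all the
    values [X j u] converge at once. A Riemann sum involves finitely many of them and passes to the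
    limit, while its error C / (m + 1) is uniform in j. *)
Lemma bernstein_quantile : exists Y : R -> R,
  [/\ {homo Y : u v /~ u <= v}, (forall u, 0 <= Y u <= 1) &
      forall y, 0 < y -> \int[mu]_(u in `[0, C]) Y u `^ y = E 0 y].
Proof.
have [U [UU Uoo]] := ultraFilterLemma (@eventually_filter).
have UP : ProperFilter U by exact: ultra_proper.
have /choice[Y HY] u : exists v : R, 0 <= v <= 1 /\ X ^~ u @ U --> v.
  by have [v ? ?] := ultra_cvg01 UU (X01 ^~ u); exists v.
have Y01 u : 0 <= Y u <= 1 by have [] := HY u.
have Yc u : X ^~ u @ U --> Y u by have [] := HY u.
have Ydec : {homo Y : u v /~ u <= v}.
  move=> u v uv; apply: (ler_cvg_to (Yc u) (Yc v)).
  by apply: nearW => j; exact: Xdec.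
exists Y; split=> // y y0.
have pow_dec (g : R -> R) : {homo g : u v /~ u <= v} -> (forall u, 0 <= g u <= 1) ->
    {homo (fun u => g u `^ y) : u v /~ u <= v}.
  move=> gd g01 u v uv; have /andP[gu _] := g01 u; have /andP[gv _] := g01 v.
  by rewrite ge0_ler_powR ?nnegrE ?(ltW y0)// gd.
have pow_01 (g : R -> R) : (forall u, 0 <= g u <= 1) -> forall u, 0 <= g u `^ y <= 1.
  have p1 : (1 : R) `^ y = 1 by rewrite powR1.
  move=> g01 u; rewrite powR_ge0/= -[leRHS]p1.
  by have /andP[gu g1] := g01 u; rewrite ge0_ler_powR ?nnegrE ?(ltW y0).
pose Rm m (g : R -> R) := C / m.+1%:R * \sum_(k < m.+1) g (k%:R * (C / m.+1%:R)) `^ y.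
have IU : I ^~ y @ U --> E 0 y by apply: cvg_trans (I_cvg y0); exact: cvg_app.
have main m : `|\int[mu]_(u in `[0, C]) Y u `^ y - E 0 y| <= 2 * C * harmonic m.
  have H1 := monotone_riemann_dist (pow_dec Y Ydec Y01) (pow_01 Y Y01) m (ltW C0).
  have RU : (fun j => Rm m (X j)) @ U --> Rm m Y.
    apply: cvgMl_tmp.
    apply: (@cvg_sum_ord _ U _ m.+1 (fun k j => X j (k%:R * (C / m.+1%:R)) `^ y)
      (fun k => Y (k%:R * (C / m.+1%:R)) `^ y)) => k.
    apply: cvg_powR => //; first by move=> j; have /andP[] := X01 j (k%:R * (C / m.+1%:R)).
    by have /andP[] := Y01 (k%:R * (C / m.+1%:R)).
  have H2 : `|E 0 y - Rm m Y| <= C / m.+1%:R.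
    apply: (ler_cvg_to (cvg_norm (cvgB IU RU)) (cvg_cst (C / m.+1%:R))).
    apply: nearW => j.
    rewrite -[Z in `|Z|]/(I j y - Rm m (X j)) -X_integral//.
    exact: (monotone_riemann_dist (pow_dec _ (@Xdec j) (X01 j)) (pow_01 _ (X01 j)) m (ltW C0)).
  have -> : 2 * C * harmonic m = C / m.+1%:R + C / m.+1%:R.
    by rewrite /harmonic/=; ring.
  have -> : \int[mu]_(u in `[0, C]) Y u `^ y - E 0 y =
    (\int[mu]_(u in `[0, C]) Y u `^ y - Rm m Y) - (E 0 y - Rm m Y) by ring.
  by rewrite (le_trans (ler_normB _ _))// lerD.
have hc : (fun m => 2 * C * harmonic m) @ \oo --> (0 : R).
  by rewrite -[X in _ --> X](mulr0 (2 * C)); apply: cvgMl_tmp; exact: cvg_harmonic.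
apply/eqP; rewrite -subr_eq0 -normr_le0.
by apply: (ler_cvg_to (cvg_cst _) hc); apply: nearW => m; exact: main.
Qed.

(** Lebesgue measure on [0, C] is the probability space of the quantile function [Y], and
    [Z = - ln Y] turns its powers into exponentials. *)
Lemma bernstein : exists d (T : measurableType d)
    (P : {finite_measure set T -> \bar R}) (Z : T -> R),
  [/\ measurable_fun setT Z, (forall u, 0 <= Z u) &
      forall y, 0 < y -> \int[P]_u expR (- y * Z u) = E 0 y].
Proof.
have [Y [Ydec Y01 HY]] := bernstein_quantile.
have mY : measurable_fun setT Y by apply: nonincreasing_measurable => // u v; exact: Ydec.
(* Points where [Y] vanishes would correspond to an infinite [Z]; their powers contribute 0, so the
   measure is restricted to [B]. *)
pose B : set R := [set u | 0 < Y u].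
have mB : measurable B.
  have := mY measurableT `]0, +oo[%classic (measurable_itv _).
  rewrite setTI (_ : _ @^-1` _ = B)//.
  by apply/seteqP; split=> u; rewrite /B/= in_itv/= andbT.
pose I0C : set R := `[0, C]%classic.
have mD : measurable (I0C `&` B : set (measurableTypeR R)) by apply: measurableI => //; exact: measurable_itv.
have muD : (mu (I0C `&` B) < +oo)%E.
  apply: (@le_lt_trans _ _ (mu I0C)).
    by apply: le_measure; rewrite ?inE//; exact: measurable_itv.
  by rewrite /I0C lebesgue_measure_itv/=; case: ifP => // _; rewrite -EFinB ltry.
have Z0 u : 0 <= - ln (Y u) by have /andP[_ ?] := Y01 u; rewrite oppr_ge0 ln_le0.
have mZ : measurable_fun setT (fun u => - ln (Y u)).
  by apply: measurableT_comp => //; exact: measurableT_comp.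
exists _, (measurableTypeR R), (mfrestr mD muD), (fun u => - ln (Y u)); split=> // y y0.
rewrite Rintegral_mfrestr; last first.
  apply: (@finite_integrable_bounded _ _ _ 1).
    by apply: measurableT_comp => //; apply: measurable_funM.
  move=> u; rewrite ger0_norm ?expR_ge0// -[leRHS]expR0 ler_expR mulNr oppr_le0.
  by rewrite mulr_ge0// ltW.
rewrite Rintegral_mkcondr -HY//; apply: eq_Rintegral => u _.
rewrite patchE; case: ifPn.
  rewrite inE/= => Yu; rewrite /powR gt_eqF//; congr expR; ring.
rewrite notin_setE/= => /negP; rewrite -leNgt => Yu.
have -> : Y u = 0 by apply/eqP; rewrite eq_le Yu; have /andP[] := Y01 u.
by rewrite powR0// gt_eqF.
Qed.

End Bernstein.

(** * Poisson and conjugate Poisson integrals *)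

Section Reflection.
Context {R : realType}.
Local Notation mu := (@lebesgue_measure R).

(** Split at the origin, the integral is a sum of two half-line integrals that reflection
    exchanges. *)
Lemma ge0_integral_reflect (f : R -> R) : (forall t, 0 <= f t) -> continuous f ->
  (\int[mu]_t (f (- t))%:E = \int[mu]_t (f t)%:E)%E.
Proof.
have half (g : R -> R) : (forall t, 0 <= g t) -> continuous g ->
    (\int[mu]_t (g t)%:E = \int[mu]_(t in `[0%R, +oo[) (g (- t))%:E
                          + \int[mu]_(t in `[0%R, +oo[) (g t)%:E)%E.
  move=> g0 cg.
  have mg : measurable_fun [set: R] g by exact: continuous_measurable_fun.
  have mN : measurable [set x : R | 0 <= x]%R by rewrite -set_itvcy.
  rewrite -(setUv [set x : R | 0 <= x]%R) ge0_integral_setU//= ; last 4 first.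
    exact: measurableC.
    by apply/measurable_EFinP; rewrite setUv.
    by move=> x _; rewrite lee_fin.
    exact/disj_setPCl.
  rewrite addeC -set_itvcy// setCitvr; congr (_ + _)%E.
  rewrite integral_itv_bndo_bndc; last exact/measurable_EFinP/measurable_funTS.
  rewrite -{1}oppr0 ge0_integration_by_substitutionNy//.
  exact: continuous_subspaceT.
move=> f0 cf.
have cfN : continuous (fun t => f (- t)).
  by move=> t; apply: continuous_comp; [exact: opp_continuous|exact: cf].
rewrite (half f)// (half (fun t => f (- t)))// addeC.
by under [in X in (_ + X)%E]eq_integral do rewrite opprK.
Qed.

(** Writes f as |f| - (|f| - f), a difference of nonnegative functions which, unlike positive and
    negative parts, needs only continuity of the norm. *)
Lemma Rintegral_reflect (f : R -> R) : continuous f ->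
  mu.-integrable setT (EFin \o f) -> \int[mu]_t f (- t) = \int[mu]_t f t.
Proof.
move=> cf fi.
have cn : continuous (fun t => `|f t|).
  by move=> t; apply: continuous_comp; [exact: cf|exact: norm_continuous].
have cd : continuous (fun t => `|f t| - f t).
  by move=> t; apply: cvgB; [exact: cn|exact: cf].
have inn : mu.-integrable setT (EFin \o (fun t => `|f t|)) by exact: integrable_norm.
have idf : mu.-integrable setT (EFin \o (fun t => `|f t| - f t)).
  by have := integrableB measurableT inn fi; apply: eq_integrable.
have reflect_integrable (g : R -> R) : (forall t, 0 <= g t) -> continuous g ->
    mu.-integrable setT (EFin \o g) -> mu.-integrable setT (EFin \o (fun t => g (- t))).
  move=> g0 cg gi; apply/integrableP; split.
    apply/measurable_EFinP; apply: continuous_measurable_fun => t.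
    by apply: continuous_comp; [exact: opp_continuous|exact: cg].
  under eq_integral => t _ do rewrite /= ger0_norm//.
  rewrite [ltLHS]ge0_integral_reflect//.
  have /integrableP[_] := gi.
  by under eq_integral => t _ do rewrite /= ger0_norm//.
have d0 t : 0 <= `|f t| - f t by rewrite subr_ge0 ler_norm.
have -> : \int[mu]_t f t = \int[mu]_t `|f t| - \int[mu]_t (`|f t| - f t).
  by rewrite -RintegralB//; apply: eq_Rintegral => t _; ring.
have -> : \int[mu]_t f (- t) = \int[mu]_t `|f (- t)| - \int[mu]_t (`|f (- t)| - f (- t)).
  rewrite -RintegralB//; first by apply: eq_Rintegral => t _; ring.
  - exact: (reflect_integrable (fun t => `|f t|)).
  - exact: (reflect_integrable (fun t => `|f t| - f t)).
rewrite /Rintegral (ge0_integral_reflect (f := fun t => `|f t|))//.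
by rewrite (ge0_integral_reflect (f := fun t => `|f t| - f t)).
Qed.

Lemma Rintegral_odd (f : R -> R) : continuous f ->
  mu.-integrable setT (EFin \o f) -> (forall t, f (- t) = - f t) ->
  \int[mu]_t f t = 0.
Proof.
move=> cf fi fodd; have := Rintegral_reflect cf fi.
under eq_Rintegral do rewrite fodd -mulN1r.
rewrite RintegralZl//; lra.
Qed.

End Reflection.

Section Kernels.
Context {R : realType}.
Local Notation mu := (@lebesgue_measure R).
Implicit Types (h : R -> R) (y M t c : R).

(** Up to the factors y / pi and 1 / pi, these are the Poisson and conjugate Poisson integrals of
    [h] at the point i y; the term t / (t^2 + 1) makes the second one converge for bounded [h] and
    vanish at y = 1. *)
Definition poisson h y := \int[mu]_t (h t * (t ^+ 2 + y ^+ 2)^-1).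
Definition conjugate h y :=
  \int[mu]_t (h t * (t / (t ^+ 2 + 1) - t / (t ^+ 2 + y ^+ 2))).

Lemma sqr_addr_gt0 y t : 0 < y -> 0 < t ^+ 2 + y ^+ 2.
Proof. by move=> y0; rewrite ltr_wpDl ?sqr_ge0// exprn_gt0. Qed.

Lemma sqr_add1_gt0 t : 0 < t ^+ 2 + 1.
Proof. by rewrite ltr_wpDl ?sqr_ge0. Qed.

Lemma continuous_cauchy_kernel y : 0 < y ->
  continuous (fun t : R => (t ^+ 2 + y ^+ 2)^-1).
Proof.
move=> y0 t; apply: cvgV; first by rewrite gt_eqF// sqr_addr_gt0.
by apply: cvgD; [exact: exprn_continuous|exact: cvg_cst].
Qed.

Lemma continuous_conjugate_kernel y : 0 < y ->
  continuous (fun t : R => t / (t ^+ 2 + 1) - t / (t ^+ 2 + y ^+ 2)).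
Proof.
move=> y0 t; apply: cvgB; apply: cvgM; try exact: cvg_id.
  have := @continuous_cauchy_kernel 1 ltr01; under eq_fun do rewrite expr1n.
  exact.
exact: continuous_cauchy_kernel.
Qed.

Variables (h : R -> R) (M : R).
Hypotheses (ch : continuous h) (hM : forall t, `|h t| <= M).

Let mh : measurable_fun setT h. Proof. exact: continuous_measurable_fun. Qed.

Lemma poisson_integrable y : 0 < y ->
  mu.-integrable setT (EFin \o (fun t => h t * (t ^+ 2 + y ^+ 2)^-1)).
Proof.
move=> y0; apply: (lebesgue_integrable_bounded_mul mh hM).
by have [] := cauchy_kernel_integral y0.
Qed.

Lemma conjugate_integrable y : 0 < y ->
  mu.-integrable setT
    (EFin \o (fun t => h t * (t / (t ^+ 2 + 1) - t / (t ^+ 2 + y ^+ 2)))).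
Proof.
move=> y0; apply: (lebesgue_integrable_bounded_mul mh hM).
exact: integrable_conjugate_kernel.
Qed.

Lemma poisson_reflect y : 0 < y -> poisson (fun t => h (- t)) y = poisson h y.
Proof.
move=> y0; rewrite /poisson -[RHS]Rintegral_reflect; last 2 first.
- by move=> t; apply: cvgM; [exact: ch|exact: continuous_cauchy_kernel].
- exact: poisson_integrable.
by apply: eq_Rintegral => t _; rewrite sqrrN.
Qed.

Lemma conjugate_reflect y : 0 < y ->
  conjugate (fun t => h (- t)) y = - conjugate h y.
Proof.
move=> y0; rewrite /conjugate -[in RHS]Rintegral_reflect; last 2 first.
- by move=> t; apply: cvgM; [exact: ch|exact: continuous_conjugate_kernel].
- exact: conjugate_integrable.
rewrite -[RHS]mulN1r -RintegralZl//; last first.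
  have mhN : measurable_fun setT (fun t => h (- t)).
    by apply: measurableT_comp.
  have i := lebesgue_integrable_bounded_mul mhN (fun t => hM (- t)) (integrable_conjugate_kernel y0).
  have := integrable_scale (-1) i; apply: eq_integrable => //.
  by move=> t _ /=; congr EFin; rewrite sqrrN; ring.
by apply: eq_Rintegral => t _; rewrite sqrrN; ring.
Qed.

Lemma poisson_bound y : 0 < y -> `|y * poisson h y| <= M * pi.
Proof.
move=> y0; have [ik Ik] := cauchy_kernel_integral y0.
rewrite normrM (gtr0_norm y0) mulrC -ler_pdivlMr//.
rewrite (le_trans (le_normr_Rintegral _ (poisson_integrable y0)))//.
rewrite -mulrA -Ik -RintegralZl//; apply: le_Rintegral => //.
- by apply: integrable_norm; exact: poisson_integrable.
- exact: integrable_scale.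
- move=> t _; have k0 := sqr_addr_gt0 t y0.
  by rewrite normrM [X in _ * X]ger0_norm ?invr_ge0 ?(ltW k0)// ler_wpM2r// invr_ge0 ltW.
Qed.

End Kernels.

(** * Uniqueness for Poisson and conjugate Poisson integrals *)

Section Uniqueness.
Context {R : realType}.
Local Notation mu := (@lebesgue_measure R).

Lemma stieltjes_even_eq0 (k : R -> R) : continuous k ->
  mu.-integrable setT (EFin \o k) -> (forall t, k (- t) = k t) ->
  (forall c, 0 < c -> \int[mu]_t ((1 + c * (t ^+ 2 + 1)^-1)^-1 * k t) = 0) ->
  forall t, k t = 0.
Proof.
move=> ck ik ek H t0.
have c1 : continuous (fun t : R => (t ^+ 2 + 1)^-1).
  have := @continuous_cauchy_kernel R 1 ltr01; under eq_fun do rewrite expr1n.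
  exact.
have m1 : measurable_fun setT (fun t : R => (t ^+ 2 + 1)^-1).
  exact: continuous_measurable_fun.
have b1 (t : R) : 0 <= (t ^+ 2 + 1)^-1 <= 1.
  rewrite invr_ge0 ltW ?sqr_add1_gt0//= invf_le1 ?sqr_add1_gt0//.
  by rewrite lerDr sqr_ge0.
apply: (@even_moments_eq0 _ k (fun t => (t ^+ 2 + 1)^-1)) => //.
- move=> s t st; rewrite ltf_pV2 ?posrE ?sqr_add1_gt0// ltrD2r.
  by rewrite -[ltLHS]real_normK ?num_real// -[ltRHS]real_normK ?num_real// ltrXn2r// ?nnegrE.
- exact: c1.
- exact: ck.
- by apply: stieltjes_moments => //; exact: m1.
Qed.

(** With y^2 = 1 + c and x = 1 / (t^2 + 1), one has x / (1 + c x) = 1 / (t^2 + y^2). So Poisson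
    integrals give the Stieltjes transform of the even part of [h], and conjugate ones that of the
    odd part, each with a suitable weight. *)
Lemma poisson_conjugate_unique (h : R -> R) (M : R) : continuous h ->
  (forall t, `|h t| <= M) ->
  (forall y, 0 < y -> poisson h y = 0) ->
  (forall y, 0 < y -> conjugate h y = 0) -> forall t, h t = 0.
Proof.
move=> ch hM hA hB.
have chN : continuous (fun t => h (- t)).
  by move=> t; apply: continuous_comp; [exact: opp_continuous|exact: ch].
have hNM t : `|h (- t)| <= M by exact: hM.
have c1 : continuous (fun t : R => (t ^+ 2 + 1 ^+ 2)^-1).
  exact: continuous_cauchy_kernel.
have sq (c : R) : 0 < c -> 0 < Num.sqrt (1 + c) /\ Num.sqrt (1 + c) ^+ 2 = 1 + c.
  by move=> c0; rewrite sqrtr_gt0 sqr_sqrtr; lra.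
have even t : h t + h (- t) = 0.
  pose k t := (h t + h (- t)) * (t ^+ 2 + 1 ^+ 2)^-1.
  have kz : forall t, k t = 0.
    apply: stieltjes_even_eq0.
    - move=> s; apply: cvgM; last exact: c1.
      by apply: cvgD; [exact: ch|exact: chN].
    - have := integrableD measurableT (poisson_integrable ch hM ltr01)
        (poisson_integrable chN hNM ltr01).
      by apply: eq_integrable => // s _; rewrite /= -EFinD /k mulrDl.
    - by move=> s; rewrite /k opprK sqrrN addrC.
    - move=> c c0; have [y0 ysq] := sq c c0; set y := Num.sqrt (1 + c) in y0 ysq.
      transitivity (\int[mu]_t (h t * (t ^+ 2 + y ^+ 2)^-1
          + h (- t) * (t ^+ 2 + y ^+ 2)^-1)).
        apply: eq_Rintegral => s _; rewrite /k ysq expr1n.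
        have := sqr_add1_gt0 s; have s2 := sqr_ge0 s.
        have s1 : s ^+ 2 + 1 != 0 by rewrite gt_eqF// sqr_add1_gt0.
        have s3 : s ^+ 2 + (1 + c) != 0 by rewrite gt_eqF//; lra.
        have s4 : s ^+ 2 + 1 + c != 0 by rewrite gt_eqF//; lra.
        by move=> _; field; rewrite ?s1 ?s3 ?s4.
      rewrite RintegralD//; [|exact: poisson_integrable..].
      rewrite -/(poisson h y) -[X in _ + X]/(poisson (fun t => h (- t)) y).
      by rewrite (poisson_reflect ch hM)// hA// addr0.
  have := kz t; move/eqP; rewrite mulf_eq0 invr_eq0 [X in _ || X]gt_eqF ?orbF; last first.
    by rewrite sqr_addr_gt0.
  by move/eqP.
have odd t : t != 0 -> h t - h (- t) = 0.
  move=> t0.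
  (* The factor t makes [k] even, and the conjugate kernel equals c t / ((t^2 + 1) (t^2 + y^2));
     this accounts for the second power of the weight and for [c^-1] below. *)
  pose k t := (h t - h (- t)) * (t * ((t ^+ 2 + 1 ^+ 2)^-1 * (t ^+ 2 + 1 ^+ 2)^-1)).
  have kz : forall t, k t = 0.
    apply: stieltjes_even_eq0.
    - move=> s; apply: cvgM; first by apply: cvgB; [exact: ch|exact: chN].
      by apply: cvgM; [exact: cvg_id|apply: cvgM; exact: c1].
    - have mb : measurable_fun setT (fun t : R => (h t - h (- t)) * (t * (t ^+ 2 + 1 ^+ 2)^-1)).
        apply: continuous_measurable_fun => s.
        apply: cvgM; first by apply: cvgB; [exact: ch|exact: chN].
        by apply: cvgM; [exact: cvg_id|exact: c1].
      have bb s : `|(h s - h (- s)) * (s * (s ^+ 2 + 1 ^+ 2)^-1)| <= (M + M) * 1.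
        rewrite normrM ler_pM// ?(le_trans (ler_normB _ _)) ?lerD//.
        have p1 := sqr_addr_gt0 s (@ltr01 R).
        rewrite normrM [X in _ * X]ger0_norm ?invr_ge0 ?(ltW p1)// ler_pdivrMr// mul1r.
        by rewrite expr1n -[s ^+ 2]real_normK ?num_real//; have := normr_ge0 s; nra.
      have [i1 _] := cauchy_kernel_integral (@ltr01 R).
      have := lebesgue_integrable_bounded_mul mb bb i1.
      by apply: eq_integrable => // s _; rewrite /= /k; congr EFin; ring.
    - by move=> s; rewrite /k opprK sqrrN; ring.
    - move=> c c0; have [y0 ysq] := sq c c0; set y := Num.sqrt (1 + c) in y0 ysq.
      transitivity (\int[mu]_t (c^-1 * (h t * (t / (t ^+ 2 + 1) - t / (t ^+ 2 + y ^+ 2))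
          - h (- t) * (t / (t ^+ 2 + 1) - t / (t ^+ 2 + y ^+ 2))))).
        apply: eq_Rintegral => s _; rewrite /k ysq expr1n.
        have s2 := sqr_ge0 s.
        have s1 : s ^+ 2 + 1 != 0 by rewrite gt_eqF// sqr_add1_gt0.
        have s3 : s ^+ 2 + (1 + c) != 0 by rewrite gt_eqF//; lra.
        have s4 : s ^+ 2 + 1 + c != 0 by rewrite gt_eqF//; lra.
        have s5 : c != 0 by rewrite gt_eqF.
        by field; rewrite ?s1 ?s3 ?s4 ?s5.
      have i1 := conjugate_integrable ch hM y0.
      have i2 := conjugate_integrable chN hNM y0.
      rewrite RintegralZl//; last first.
        by have := integrableB measurableT i1 i2; apply: eq_integrable.
      rewrite RintegralB// -/(conjugate h y) -[X in _ - X]/(conjugate (fun t => h (- t)) y).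
      by rewrite (conjugate_reflect ch hM)// hB// oppr0 subr0 mulr0.
  have p1 := sqr_addr_gt0 t (@ltr01 R).
  have := kz t; move/eqP; rewrite !mulf_eq0 !invr_eq0 (negbTE t0) [X in _ || (_ || (X || _))]gt_eqF//.
  by rewrite [X in _ || (_ || (_ || X))]gt_eqF// !orbF => /eqP.
(* The factor t hides the odd part at 0, where the even part alone gives 2 h(0) = 0. *)
move=> t; have [->|t0] := eqVneq t 0.
  by have := even 0; rewrite oppr0; lra.
by have := even t; have := odd t t0; lra.
Qed.

End Uniqueness.

(** * Laplace transforms of finite measures *)

Section LaplaceCM.
Context {R : realType} d (T : measurableType d).
Variables (P : {finite_measure set T -> \bar R}) (Z rho : T -> R) (M : R).
Hypotheses (mZ : measurable_fun setT Z) (Z0 : forall s, 0 <= Z s).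
Hypotheses (mrho : measurable_fun setT rho) (rho0 : forall s, 0 <= rho s).
Hypothesis rhoM : forall s, rho s <= M.

(** Half of the exponential absorbs one factor x, as x exp(-(c / 2) x) <= 2 / c; the other half is
    left to the induction. *)
Lemma pow_expR_bounded n (c : R) : 0 < c ->
  exists B : R, forall x, 0 <= x -> x ^+ n * expR (- c * x) <= B.
Proof.
elim: n c => [|n IH] c c0.
  exists 1 => x x0; rewrite expr0 mul1r -[leRHS]expR0 ler_expR mulNr oppr_le0.
  by rewrite mulr_ge0// ltW.
have c2 : 0 < c / 2 by rewrite divr_gt0.
have [B HB] := IH _ c2; exists (B * (c / 2)^-1) => x x0.
have -> : x ^+ n.+1 * expR (- c * x) =
    (x ^+ n * expR (- (c / 2) * x)) * (x * expR (- (c / 2) * x)).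
  have -> : - c * x = - (c / 2) * x + - (c / 2) * x by field.
  by rewrite expRD exprS; ring.
rewrite ler_pM ?HB ?mulr_ge0 ?exprn_ge0 ?expR_ge0//.
rewrite mulNr expRN ler_pdivrMr ?expR_gt0// mulrC ler_pdivlMr//.
by rewrite (le_trans _ (expR_ge1Dx _))// mulrC lerDr.
Qed.

(** [g n] is the n-th derivative in y of the integrand, and [V n] turns out to be the n-th
    derivative of the integral. *)
Let g n y s := rho s * ((- Z s) ^+ n * expR (- y * Z s)).
Let V n y := \int[P]_s g n y s.

Let mg n y : measurable_fun setT (g n y).
Proof.
apply: measurable_funM => //; apply: measurable_funM.
  by apply: measurable_funX; exact: measurableT_comp.
by apply: measurableT_comp => //; exact: measurable_funM.
Qed.

Let g_bound n (c : R) : 0 < c ->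
  exists2 B : R, 0 <= B & forall (y : R) s, c <= y -> `|g n y s| <= B.
Proof.
move=> c0; have [B HB] := pow_expR_bounded n c0.
have B0 : 0 <= B.
  by have := HB 0 (lexx _); apply: le_trans; rewrite mulr_ge0 ?expR_ge0// exprn_ge0.
exists (M * B) => [|y s cy].
  by rewrite mulr_ge0// (le_trans (rho0 point) (rhoM point)).
rewrite normrM (ger0_norm (rho0 s)) ler_pM//.
rewrite normrM normrX normrN (ger0_norm (Z0 s)) (ger0_norm (expR_ge0 _)).
rewrite (le_trans _ (HB _ (Z0 s)))// ler_wpM2l ?exprn_ge0// ler_expR !mulNr lerN2.
by rewrite ler_wpM2r.
Qed.

Let ig n y : 0 < y -> P.-integrable setT (EFin \o g n y).
Proof.
move=> y0; have [B _ HB] := g_bound n y0.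
by apply: (@finite_integrable_bounded _ _ _ _ B) => [|s]; [exact: mg|exact: HB].
Qed.

Let dg n (y : R) s : is_derive y 1 (g n ^~ s) (g n.+1 y s).
Proof.
have de : is_derive y 1 (fun y => expR (- y * Z s)) (- Z s * expR (- y * Z s)).
  have -> : (fun y => expR (- y * Z s)) = (fun y => expR (- Z s * y)).
    by apply/funext => x; congr expR; ring.
  by have := is_derive_expR_scale (Z s) y; rewrite (_ : - Z s * y = - y * Z s)//; ring.
apply: (is_derive_eq (is_deriveZ (rho s) (is_deriveZ ((- Z s) ^+ n) de))).
by rewrite /g /GRing.scale/= exprS; ring.
Qed.

Let dV n (y : R) : 0 < y -> is_derive y 1 (V n) (V n.+1 y).
Proof.
move=> y0; have c0 : 0 < y / 2 by rewrite divr_gt0.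
have [B B0 HB] := g_bound n.+1 c0.
have d1 x s : partial1of2 (g n) x s = g n.+1 x s.
  by rewrite partial1of2E; exact: (@derive_val _ _ _ _ _ _ _ (dg n x s)).
(* A neighbourhood of y away from 0, on which the derivative of the integrand is dominated by the
   constant B. *)
pose I : set R := `]y / 2, y * 2[%classic.
have Iy : I y by rewrite /I/= in_itv/=; apply/andP; split; lra.
have I1 x : I x -> P.-integrable setT (EFin \o g n x).
  by rewrite /I/= in_itv/= => /andP[xy _]; apply: ig; exact: lt_trans xy.
have I2 x s : I x -> setT s -> derivable (g n ^~ s) x 1.
  by move=> _ _; exact: (@ex_derive _ _ _ _ _ _ _ (dg n x s)).
have I3 : P.-integrable setT (EFin \o (cst B : T -> R)).
  exact: finite_measure_integrable_cst.
have I4 x s : I x -> setT s -> `|partial1of2 (g n) x s| <= (cst B : T -> R) s.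
  by rewrite /I/= in_itv/= => /andP[xy _] _; rewrite d1; apply: HB; exact: ltW.
apply: DeriveDef.
  exact: (derivable_under_integral measurableT Iy I1 I2 (fun=> B0) I3 I4).
rewrite -derive1E.
rewrite (differentiation_under_integral measurableT Iy I1 I2 (fun=> B0) I3 I4).
by apply: eq_Rintegral => s _; exact: d1.
Qed.

Let derive1n_V n (y : R) : 0 < y -> derive1n n (V 0) y = V n y.
Proof.
elim: n y => [//|n IH] y y0.
rewrite derive1nS derive1E.
have H : is_derive y 1 (derive1n n (V 0)) (V n.+1 y).
  apply: near_eq_is_derive (dV n y0).
  have : \forall z \near y, 0 < z by exact: lt_nbhsr.
  by apply: filterS => z z0; rewrite IH.
exact: derive_val.
Qed.

Lemma laplace_completely_monotonic :
  completely_monotonic 0%E +oo%E (fun y => \int[P]_s (rho s * expR (- y * Z s))).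
Proof.
have -> : (fun y => \int[P]_s (rho s * expR (- y * Z s))) = V 0.
  by apply/funext => y; apply: eq_Rintegral => s _; rewrite /g expr0 mul1r.
split=> n y; rewrite lte_fin => y0 _.
  apply: (@ex_derive _ _ _ _ _ _ (V n.+1 y)).
  apply: near_eq_is_derive (dV n y0).
  have : \forall z \near y, 0 < z by exact: lt_nbhsr.
  by apply: filterS => z z0; rewrite derive1n_V.
rewrite derive1n_V// -RintegralZl//; last exact: ig.
apply: Rintegral_ge0 => s _; rewrite /g [(- Z s) ^+ n]exprNn.
have -> : (-1) ^+ n * (rho s * ((-1) ^+ n * Z s ^+ n * expR (- y * Z s))) =
    ((-1) ^+ n * (-1) ^+ n) * (rho s * (Z s ^+ n * expR (- y * Z s))) by ring.
by rewrite -expr2 sqrr_sign mul1r !mulr_ge0 ?exprn_ge0 ?expR_ge0.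
Qed.

End LaplaceCM.

Section Bounded.
Context {R : realType}.

(** The half undoes the weights 1 + sgn s and 1 - sgn s, which equal 2 on one half-line and split
    the mass at 0 evenly between the two functions. *)
Lemma bernstein_half (w : R -> R) (C : R) : completely_monotonic 0%E +oo%E w ->
  0 < C -> (forall y, 0 < y -> w y <= C) ->
  exists d (T : measurableType d) (P : {finite_measure set T -> \bar R}) (Z : T -> R),
  [/\ measurable_fun setT Z, (forall u, 0 <= Z u) &
      forall y, 0 < y -> \int[P]_u expR (- y * Z u) = w y / 2].
Proof.
move=> [w1 w2] C0 wC.
pose E n y := (-1) ^+ n / 2 * derive1n n w y.
have dE n (y : R) : 0 < y -> is_derive y 1 (E n) (- E n.+1 y).
  move=> y0; have dw := derivableP (w1 n y _ _).
  apply: (is_derive_eq (is_deriveZ ((-1) ^+ n / 2) (dw _ _))); rewrite ?lte_fin ?ltry//.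
  by rewrite /E derive1nS derive1E /GRing.scale/= exprS; ring.
have E0 n y : 0 < y -> 0 <= E n y.
  by move=> y0; rewrite /E mulrAC divr_ge0// w2 ?lte_fin ?ltry.
have EC y : 0 < y -> E 0 y <= C.
  move=> y0; have := wC y y0; have := w2 0 y; rewrite lte_fin ltry => /(_ y0 isT).
  by rewrite /E !expr0 /derive1n/=; lra.
have [d [T [P [Z [mZ Z0 HZ]]]]] := bernstein dE E0 EC C0.
exists d, T, P, Z; split=> // y y0; rewrite HZ// /E expr0 /derive1n/=; ring.
Qed.

End Bounded.

Lemma measurable_sgr {R : realType} : measurable_fun setT (@Num.sg R).
Proof.
apply: nondecreasing_measurable => // u v uv.
have sg1 : `|Num.sg v| <= 1 by rewrite normr_sg; case: (v != 0).
have [u0|u0|u0] := ltgtP u 0.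
- by rewrite (ltr0_sg u0); move: sg1; rewrite ler_norml => /andP[].
- by rewrite (gtr0_sg u0) (gtr0_sg (lt_le_trans u0 uv)).
- by rewrite u0 sgr0 sgr_ge0 -u0.
Qed.

Local Open Scope complex_scope.

(** * Transforms of characteristic functions *)

Section Transforms.
Context {R : realType} d (T : measurableType d).
Variables (P : {finite_measure set T -> \bar R}) (Z : T -> R).
Hypothesis mZ : measurable_fun setT Z.
Local Notation mu := (@lebesgue_measure R).

Let ucos (t : R) := \int[P]_s cos (t * Z s).
Let vsin (t : R) := \int[P]_s sin (t * Z s).

Let i1 : P.-integrable setT (EFin \o (cst 1 : T -> R)).
Proof. exact: finite_measure_integrable_cst. Qed.

Let mtZ (h : R -> R) t : continuous h -> measurable_fun setT (fun s => h (t * Z s)).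
Proof.
move=> ch; apply: measurableT_comp; first exact: continuous_measurable_fun.
exact: measurable_funM.
Qed.

Let trig_continuous (h : R -> R) : continuous h -> (forall x, `|h x| <= 1) ->
  continuous (fun t : R => \int[P]_s h (t * Z s)).
Proof.
move=> ch h1.
have -> : (fun t : R => \int[P]_s h (t * Z s)) = (fun t : R => \int[P]_s (h (t * Z s) * cst 1 s)).
  by apply/funext => t; apply: eq_Rintegral => s _; rewrite mulr1.
apply: continuous_Rintegral_bounded => // [t|s t]; first exact: mtZ.
apply: continuous_comp; last exact: ch.
by apply: cvgMr_tmp; exact: cvg_id.
Qed.

Let trig_bounded (h : R -> R) t : continuous h -> (forall x, `|h x| <= 1) ->
  `|\int[P]_s h (t * Z s)| <= \int[P]_s `|(1 : R)|.
Proof.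
move=> ch h1.
have -> : \int[P]_s h (t * Z s) = \int[P]_s (h (t * Z s) * cst 1 s).
  by apply: eq_Rintegral => s _; rewrite mulr1.
by apply: le_normr_Rintegral_bounded => //; exact: mtZ.
Qed.

Let trig_Fubini (h : R -> R) (k : R -> R) : continuous h -> (forall x, `|h x| <= 1) ->
  mu.-integrable setT (EFin \o k) ->
  \int[mu]_t ((\int[P]_s h (t * Z s)) * k t) = \int[P]_s (\int[mu]_t (h (t * Z s) * k t)).
Proof.
move=> ch h1 ik.
have mB : measurable_fun setT (fun z : measurableTypeR R * T => h (z.1 * Z z.2)).
  apply: measurableT_comp; first exact: continuous_measurable_fun.
  apply: measurable_funM; first exact: measurable_fst.
  exact: (measurableT_comp mZ measurable_snd).
have := @Fubini_bounded _ _ _ _ _ mu P k (cst 1) (fun t s => h (t * Z s)) ik i1 mB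
  (fun t s => h1 _).
under eq_Rintegral do under eq_Rintegral do rewrite mulr1.
move=> ->; by under eq_Rintegral do rewrite mulr1.
Qed.

Let cos1 (x : R) : `|cos x| <= 1. Proof. by rewrite ler_norml cos_geN1 cos_le1. Qed.
Let sin1 (x : R) : `|sin x| <= 1. Proof. by rewrite ler_norml sin_geN1 sin_le1. Qed.

Lemma cos_transform_continuous : continuous ucos.
Proof. by apply: trig_continuous => //; exact: continuous_cos. Qed.

Lemma sin_transform_continuous : continuous vsin.
Proof. by apply: trig_continuous => //; exact: continuous_sin. Qed.

Lemma cos_transform_bounded t : `|ucos t| <= \int[P]_s `|(1 : R)|.
Proof. by apply: trig_bounded => //; exact: continuous_cos. Qed.

Lemma sin_transform_bounded t : `|vsin t| <= \int[P]_s `|(1 : R)|.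
Proof. by apply: trig_bounded => //; exact: continuous_sin. Qed.

Lemma poisson_cos y : 0 < y ->
  poisson ucos y = pi / y * \int[P]_s expR (- y * `|Z s|).
Proof.
move=> y0; have [ik _] := cauchy_kernel_integral y0.
rewrite /poisson trig_Fubini//; last exact: continuous_cos.
rewrite -RintegralZl//; last first.
  apply: (@finite_integrable_bounded _ _ _ _ 1) => [|s].
    apply: measurableT_comp => //; apply: measurable_funM => //.
    exact: measurableT_comp.
  rewrite ger0_norm ?expR_ge0// -[leRHS]expR0 ler_expR mulNr oppr_le0.
  by rewrite mulr_ge0// ltW.
apply: eq_Rintegral => s _; rewrite -cauchy_kernel_cos//.
apply: eq_Rintegral => t _; congr (_ * _).
by case: (ger0P (Z s)) => _; rewrite mulrC// mulNr cosN.
Qed.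

(** After Fubini, oddness of the sine brings the kernel integral back to |Z s|, at the cost of the
    sign of Z s. *)
Lemma conjugate_sin y : 0 < y ->
  conjugate vsin y =
  pi * \int[P]_s (Num.sg (Z s) * (expR (- `|Z s|) - expR (- y * `|Z s|))).
Proof.
move=> y0; have iQ := integrable_conjugate_kernel y0.
rewrite /conjugate trig_Fubini//; last exact: continuous_sin.
rewrite -RintegralZl//; last first.
  apply: (@finite_integrable_bounded _ _ _ _ (1 * (1 + 1))) => [|s].
    apply: measurable_funM; first exact: (measurableT_comp measurable_sgr).
    apply: measurable_funB; apply: measurableT_comp => //.
      by apply: measurableT_comp => //; exact: measurableT_comp.
    by apply: measurable_funM => //; exact: measurableT_comp.
  have e1 c : 0 <= c -> `|expR (- c)| <= 1.
    by move=> c0; rewrite ger0_norm ?expR_ge0// -[leRHS]expR0 ler_expR oppr_le0.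
  rewrite normrM ler_pM//; first by rewrite normr_sg; case: eqP.
  by rewrite (le_trans (ler_normB _ _))// lerD// ?mulNr e1// mulr_ge0// ltW.
apply: eq_Rintegral => s _.
rewrite mulrCA -conjugate_kernel_sin// -RintegralZl//; last first.
  apply: (@lebesgue_integrable_bounded_mul _ 1) => //.
  apply: measurableT_comp; first exact: continuous_measurable_fun (@continuous_sin R).
  exact: measurable_funM.
apply: eq_Rintegral => t _; rewrite mulrA; congr (_ * _).
have [z0|z0|z0] := ltgtP (Z s) 0.
- by rewrite ltr0_sg// ltr0_norm// mulN1r mulNr sinN opprK mulrC.
- by rewrite gtr0_sg// gtr0_norm// mul1r mulrC.
- by rewrite z0 sgr0 mul0r mulr0 sin0.
Qed.

Lemma poisson_sin y : 0 < y -> poisson vsin y = 0.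
Proof.
move=> y0; apply: Rintegral_odd.
- move=> t; apply: cvgM; first exact: sin_transform_continuous.
  exact: continuous_cauchy_kernel.
- exact: (poisson_integrable sin_transform_continuous sin_transform_bounded y0).
- move=> t; rewrite sqrrN -mulNr; congr (_ * _).
  rewrite /vsin -[RHS]mulN1r -RintegralZl//; last first.
    apply: (@finite_integrable_bounded _ _ _ _ 1) => //.
    by apply: mtZ; exact: continuous_sin.
  by apply: eq_Rintegral => s _; rewrite mulNr sinN mulN1r.
Qed.

Lemma conjugate_cos y : 0 < y -> conjugate ucos y = 0.
Proof.
move=> y0; apply: Rintegral_odd.
- move=> t; apply: cvgM; first exact: cos_transform_continuous.
  exact: continuous_conjugate_kernel.
- exact: (conjugate_integrable cos_transform_continuous cos_transform_bounded y0).
- move=> t; rewrite sqrrN -mulrN.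
  have -> : ucos (- t) = ucos t.
    by apply: eq_Rintegral => s _; rewrite mulNr cosN.
  by ring.
Qed.

End Transforms.

(** * The modified Cauchy transform on the imaginary axis *)

Section CauchyK.
Context {R : realType}.
Local Notation mu := (@lebesgue_measure R).

(** The sign [eps] treats both half-axes at once: the kernel at i eps y has the conjugate kernel as
    its real part and -eps y times the Cauchy kernel as its imaginary part. *)
Lemma cauchyK_imaginary (f : R -> R[i]) (M y eps : R) :
  continuous (fun x : R => complex.Re (f x)) ->
  continuous (fun x : R => complex.Im (f x)) ->
  (forall x, `|complex.Re (f x)| <= M) -> (forall x, `|complex.Im (f x)| <= M) ->
  0 < y -> eps ^+ 2 = 1 ->
  cauchyK f ('i * (eps * y)%:C) =
  (pi^-1 * (eps * y * poisson (fun x => complex.Re (f x)) y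
            - conjugate (fun x => complex.Im (f x)) y)) +i*
  (pi^-1 * (conjugate (fun x => complex.Re (f x)) y
            + eps * y * poisson (fun x => complex.Im (f x)) y)).
Proof.
move=> cu cv uM vM y0 eps1.
set u := fun x => complex.Re (f x) in cu uM *.
set v := fun x => complex.Im (f x) in cv vM *.
have iAu := poisson_integrable cu uM y0; have iAv := poisson_integrable cv vM y0.
have iBu := conjugate_integrable cu uM y0; have iBv := conjugate_integrable cv vM y0.
pose b t := t / (t ^+ 2 + 1) - t / (t ^+ 2 + y ^+ 2).
have kE t : ('i * (eps * y)%:C - t%:C)^-1 + (t / (t ^+ 2 + 1))%:C =
    b t +i* (- (eps * y) / (t ^+ 2 + y ^+ 2)).
  have py : t ^+ 2 + y ^+ 2 != 0 by rewrite gt_eqF// sqr_addr_gt0.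
  have p1 : t ^+ 2 + 1 != 0 by rewrite gt_eqF// sqr_add1_gt0.
  have e2 : (eps * y) ^+ 2 = y ^+ 2 by rewrite exprMn eps1 mul1r.
  have dE : (0 * (eps * y) - 1 * 0 - t) ^+ 2 + (0 * 0 + 1 * (eps * y) - 0) ^+ 2 =
      t ^+ 2 + y ^+ 2 by rewrite -e2; ring.
  apply/eqP; rewrite eq_complex/= dE; apply/andP; split; apply/eqP.
    by rewrite /b; field; rewrite py p1.
  by field.
have fE t : f t = u t +i* v t by rewrite /u /v; case: (f t).
have Re_E : Defs.Rint (fun t => complex.Re
      ((('i * (eps * y)%:C - t%:C)^-1 + (t / (t ^+ 2 + 1))%:C) * f t)) =
    conjugate u y + eps * y * poisson v y.
  rewrite /conjugate /poisson -RintegralZl// -RintegralD//; last exact: integrable_scale.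
  by apply: eq_Rintegral => t _; rewrite kE fE/= /b; ring.
have Im_E : Defs.Rint (fun t => complex.Im
      ((('i * (eps * y)%:C - t%:C)^-1 + (t / (t ^+ 2 + 1))%:C) * f t)) =
    conjugate v y - eps * y * poisson u y.
  rewrite /conjugate /poisson -RintegralZl// -RintegralB//; last exact: integrable_scale.
  by apply: eq_Rintegral => t _; rewrite kE fE/= /b; ring.
rewrite /cauchyK /Cint Re_E Im_E; apply/eqP; rewrite eq_complex/=.
by apply/andP; split; apply/eqP; ring.
Qed.

End CauchyK.

(** * Characteristic functions and complete monotonicity *)

Section CharacteristicFunctions.
Context {R : realType}.

Lemma probability_of_measure (m : {measure set R -> \bar R}) : m setT = 1%E ->
  exists p : probability R R, forall A, measurable A -> p A = m A.
Proof.
(* Normalizing a measure of total mass 1 leaves it unchanged; the Dirac mass is the default of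
   [mnormalize]. *)
move=> m1; exists (mnormalize m (dirac (0 : R))) => A _.
by rewrite /= /mnormalize/= m1 onee_eq0/= invr1 mule1.
Qed.

Lemma law_exists d (T : measurableType d)
    (P : {finite_measure set T -> \bar R}) (Z : T -> R) : measurable_fun setT Z ->
  exists m : {measure set R -> \bar R}, m setT = P setT /\
    forall (g : R -> R) (M : R), measurable_fun setT g -> (forall x, `|g x| <= M) ->
    m.-integrable setT (EFin \o g) /\ \int[m]_x g x = \int[P]_s g (Z s).
Proof.
move=> mZ; pose m0 : {measure set R -> \bar R} := pushforward P Z.
exists (m0 mZ); split; first by rewrite /m0/= /pushforward preimage_setT.
move=> g M mg gM.
have mgE : measurable_fun setT (EFin \o g) by exact/measurable_EFinP.
have ig : P.-integrable (Z @^-1` setT) ((EFin \o g) \o Z).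
  rewrite preimage_setT; apply: (@finite_integrable_bounded _ _ _ _ M (g \o Z)) => [|s].
    exact: measurableT_comp.
  exact: gM.
split; first exact: (integrable_pushforward mZ mgE ig measurableT).
by rewrite /Rintegral [X in fine X](integral_pushforward mZ mgE ig measurableT) preimage_setT.
Qed.

Lemma complex_norm_bound (f : R -> R[i]) (M : R) : (forall x, `|f x| <= M%:C) ->
  (forall x, `|complex.Re (f x)| <= M) /\ (forall x, `|complex.Im (f x)| <= M).
Proof.
move=> fM.
have H x : Num.sqrt (complex.Re (f x) ^+ 2 + complex.Im (f x) ^+ 2) <= M.
  by have := fM x; rewrite normc_def lecR.
by split=> x; apply: le_trans (H x); rewrite -sqrtr_sqr ler_wsqrtr// ?lerDl ?lerDr sqr_ge0.
Qed.

Lemma characteristic_function_completely_monotonic (f : R -> R[i]) :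
  characteristic_function f ->
   exists af : R,
     (exists w : R -> R,
        completely_monotonic 0%E +oo%E w /\
        forall y : R, 0 < y -> af%:C + cauchyK f ('i * y%:C) = (w y)%:C) /\
     (exists v : R -> R,
        absolutely_monotonic -oo%E 0%E v /\
        forall y : R, y < 0 -> - (af%:C + cauchyK f ('i * y%:C)) = (v y)%:C).
Proof.
move=> [sigma fE].
have mid : measurable_fun [set: R] (fun s : R => s) by exact: measurable_id.
pose u t := \int[sigma]_s cos (t * s); pose v t := \int[sigma]_s sin (t * s).
have uE : (fun x => complex.Re (f x)) = u by apply/funext => x; rewrite fE.
have vE : (fun x => complex.Im (f x)) = v by apply/funext => x; rewrite fE.
have cu : continuous u by exact: (@cos_transform_continuous _ _ _ sigma _ mid).
have cv : continuous v by exact: (@sin_transform_continuous _ _ _ sigma _ mid).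
have uM t : `|u t| <= \int[sigma]_s `|1| by exact: (@cos_transform_bounded _ _ _ sigma _ mid t).
have vM t : `|v t| <= \int[sigma]_s `|1| by exact: (@sin_transform_bounded _ _ _ sigma _ mid t).
have mabs : measurable_fun [set: R] (fun s : R => `|s|) by exact: measurableT_comp.
have e1 (y s : R) : 0 < y -> `|expR (- y * `|s|)| <= 1.
  move=> y0; rewrite ger0_norm ?expR_ge0// -[leRHS]expR0 ler_expR mulNr oppr_le0.
  by rewrite mulr_ge0// ltW.
have sg1 (s : R) : `|Num.sg s| <= 1 by rewrite normr_sg; case: (s != 0).
have ie (y : R) : 0 < y -> sigma.-integrable setT (EFin \o (fun s => expR (- y * `|s|))).
  move=> y0; apply: (@finite_integrable_bounded _ _ _ _ 1) => [|s]; last exact: e1.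
  by apply: measurableT_comp => //; exact: measurable_funM.
have ise (y : R) : 0 < y ->
    sigma.-integrable setT (EFin \o (fun s => Num.sg s * expR (- y * `|s|))).
  by move=> y0; exact: (integrable_bounded_mul measurable_sgr sg1 (ie y y0)).
pose I y := \int[sigma]_s expR (- y * `|s|).
pose J y := \int[sigma]_s (Num.sg s * expR (- y * `|s|)).
have pi0 : pi != 0 :> R by rewrite gt_eqF// pi_gt0.
have K (y eps : R) : 0 < y -> eps ^+ 2 = 1 ->
    cauchyK f ('i * (eps * y)%:C) = (eps * I y - (J 1 - J y))%:C.
  move=> y0 eps2; rewrite (cauchyK_imaginary (M := \int[sigma]_s `|1|))//; last 4 first.
  - by rewrite uE.
  - by rewrite vE.
  - by move=> x; rewrite -[complex.Re (f x)]/((fun x => complex.Re (f x)) x) uE.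
  - by move=> x; rewrite -[complex.Im (f x)]/((fun x => complex.Im (f x)) x) vE.
  rewrite uE vE (@poisson_cos _ _ _ sigma _ mid y y0) (@conjugate_cos _ _ _ sigma _ mid y y0).
  rewrite (@poisson_sin _ _ _ sigma _ mid y y0) (@conjugate_sin _ _ _ sigma _ mid y y0).
  have -> : \int[sigma]_s (Num.sg s * (expR (- `|s|) - expR (- y * `|s|))) = J 1 - J y.
    rewrite /J -RintegralB//; [|exact: ise..].
    by apply: eq_Rintegral => s _; rewrite mulN1r mulrBr.
  rewrite -/(I y); apply/eqP; rewrite eq_complex/=; apply/andP; split; apply/eqP.
    have y1 : y != 0 by rewrite gt_eqF.
    by move: pi0; generalize (@pi R) => c c0; field; rewrite y1 c0.
  by ring.
(* For e = 1 or -1 the density 1 + e sgn s lies between 0 and 2. *)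
have CM (e : R) : e ^+ 2 = 1 ->
    completely_monotonic 0%E +oo%E (fun y => \int[sigma]_s ((1 + e * Num.sg s) * expR (- y * `|s|))).
  move=> e2.
  have eb : `|e| <= 1 by rewrite -[`|e|]ger0_norm// -sqrtr_sqr real_normK ?num_real// e2 sqrtr1.
  have bd (s : R) : `|e * Num.sg s| <= 1 by rewrite normrM mulr_ile1.
  apply: (@laplace_completely_monotonic _ _ _ sigma _ _ 2) => //.
  - apply: measurable_funD => //; apply: measurable_funM => //; exact: measurable_sgr.
  - by move=> s; have := bd s; rewrite ler_norml => /andP[? _]; lra.
  - by move=> s; have := bd s; rewrite ler_norml => /andP[_ ?]; lra.
have WE (e y : R) : 0 < y ->
    \int[sigma]_s ((1 + e * Num.sg s) * expR (- y * `|s|)) = I y + e * J y.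
  move=> y0; rewrite /I /J -RintegralZl//; last exact: ise.
  rewrite -RintegralD//; [|exact: ie|exact/integrable_scale/ise].
  by apply: eq_Rintegral => s _; ring.
(* The constant [J 1] cancels the contribution of the normalizing term t / (t^2 + 1), leaving I + J
   above the axis and, after the change of sign, I - J below. *)
exists (J 1); split.
  exists (fun y => \int[sigma]_s ((1 + 1 * Num.sg s) * expR (- y * `|s|))); split.
    by apply: CM; rewrite expr1n.
  move=> y y0; have := K y 1 y0; rewrite expr1n mul1r => ->//.
  rewrite WE//; apply/eqP; rewrite eq_complex/=.
  by apply/andP; split; apply/eqP; ring.
exists (fun x => \int[sigma]_s ((1 + -1 * Num.sg s) * expR (- - x * `|s|))); split.
  rewrite /absolutely_monotonic oppe0 /=.
  have := CM (-1); rewrite sqrrN expr1n => /(_ erefl).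
  by under [X in _ -> completely_monotonic _ _ X]eq_fun do rewrite opprK.
move=> x x0; have y0 : 0 < - x by rewrite oppr_gt0.
have Kx := K (- x) (-1) y0; rewrite sqrrN expr1n mulN1r opprK in Kx.
rewrite (Kx erefl) (WE (-1) (- x) y0); apply/eqP; rewrite eq_complex/=.
by apply/andP; split; apply/eqP; ring.
Qed.

Lemma finite_measure_of (m : {measure set R -> \bar R}) : fin_num_fun m ->
  exists P : {finite_measure set R -> \bar R}, m = P.
Proof.
move=> mfin.
have sf : sigma_finite setT m by apply: fin_num_fun_sigma_finite; rewrite ?measure0.
pose H1 := isFinite.Build _ _ _ _ mfin.
pose H2 := isSFinite.Build _ _ _ _ (sfinite_measure_sigma_finite sf).
pose H3 := isSigmaFinite.Build _ _ _ _ sf.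
pose P := HB.pack_for (FiniteMeasure.type R R) (Measure.sort m) H1 H2 H3.
by exists P; exact: eq_measure.
Qed.

Lemma sum_of_laws d1 (T1 : measurableType d1) (P1 : {finite_measure set T1 -> \bar R})
    (Z1 : T1 -> R) d2 (T2 : measurableType d2) (P2 : {finite_measure set T2 -> \bar R})
    (Z2 : T2 -> R) : measurable_fun setT Z1 -> measurable_fun setT Z2 ->
  exists m : {finite_measure set R -> \bar R},
    forall (g : R -> R) (M : R), measurable_fun setT g -> (forall x, `|g x| <= M) ->
    \int[m]_x g x = \int[P1]_s g (Z1 s) + \int[P2]_s g (Z2 s).
Proof.
move=> mZ1 mZ2.
have [m1 [m1T H1]] := law_exists P1 mZ1; have [m2 [m2T H2]] := law_exists P2 mZ2.
have mfin : fin_num_fun (measure_add m1 m2).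
  move=> A mA; rewrite ge0_fin_numE//.
  apply: (le_lt_trans (le_measure _ _ _ (@subsetT _ A))); rewrite ?inE//.
  by rewrite [ltLHS]measure_addE m1T m2T lte_add_pinfty// ltey_eq fin_num_measure.
have [m mE] := finite_measure_of mfin.
exists m => g M mg gM; have [i1 I1] := H1 g M mg gM; have [i2 I2] := H2 g M mg gM.
rewrite -I1 -I2 -mE /Rintegral [X in fine X](integral_measure_add measurableT i1 i2).
by rewrite fineD//; exact: integrable_fin_num.
Qed.

Lemma poissonB (h k : R -> R) (M N y : R) : continuous h -> (forall t, `|h t| <= M) ->
  continuous k -> (forall t, `|k t| <= N) -> 0 < y ->
  poisson (fun t => h t - k t) y = poisson h y - poisson k y.
Proof.
move=> ch hM ck kN y0; rewrite /poisson -RintegralB//; last 2 first.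
- exact: (poisson_integrable ch hM).
- exact: (poisson_integrable ck kN).
by apply: eq_Rintegral => t _; rewrite mulrBl.
Qed.

Lemma conjugateB (h k : R -> R) (M N y : R) : continuous h -> (forall t, `|h t| <= M) ->
  continuous k -> (forall t, `|k t| <= N) -> 0 < y ->
  conjugate (fun t => h t - k t) y = conjugate h y - conjugate k y.
Proof.
move=> ch hM ck kN y0; rewrite /conjugate -RintegralB//; last 2 first.
- exact: (conjugate_integrable ch hM).
- exact: (conjugate_integrable ck kN).
by apply: eq_Rintegral => t _; rewrite mulrBl.
Qed.

Lemma poisson_conjugate_inj (h k : R -> R) (M N : R) :
  continuous h -> (forall t, `|h t| <= M) ->
  continuous k -> (forall t, `|k t| <= N) ->
  (forall y, 0 < y -> poisson h y = poisson k y) ->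
  (forall y, 0 < y -> conjugate h y = conjugate k y) -> h =1 k.
Proof.
move=> ch hM ck kN ph qh t; apply/eqP; rewrite -subr_eq0; apply/eqP.
apply: (@poisson_conjugate_unique _ (fun t => h t - k t) (M + N)).
- by move=> s; apply: cvgB; [exact: ch|exact: ck].
- by move=> s; apply: le_trans (ler_normB _ _) _; rewrite lerD.
- by move=> y y0; rewrite (poissonB ch hM ck kN)// ph// subrr.
- by move=> y y0; rewrite (conjugateB ch hM ck kN)// qh// subrr.
Qed.

(** At x = 0 the cosine is 1, so f 0 = 1 says that the total mass is 1. *)
Lemma characteristic_function_of_finite_measure (f : R -> R[i])
    (m : {finite_measure set R -> \bar R}) : f 0 = 1 ->
  (forall x, complex.Re (f x) = \int[m]_s cos (x * s)) ->
  (forall x, complex.Im (f x) = \int[m]_s sin (x * s)) ->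
  characteristic_function f.
Proof.
move=> f0 fu fv.
have m1 : m setT = 1%E.
  have := fu 0; rewrite f0/=; under eq_Rintegral do rewrite mul0r cos0.
  by rewrite Rintegral_cst//= mul1r => m1; rewrite -[LHS]fineK ?fin_num_measure// -m1.
have [p pE] := probability_of_measure m1.
exists p => x; apply/eqP; rewrite eq_complex/= fu fv /Rintegral.
have pm g : (\int[m]_s g s = \int[p]_s g s)%E.
  by apply: eq_measure_integral => A mA _; exact/esym/pE.
by rewrite !pm !eqxx.
Qed.

Lemma completely_monotonic_characteristic_function (f : R -> R[i]) (M af : R) (w v : R -> R) :
  continuous (fun x : R => complex.Re (f x)) ->
  continuous (fun x : R => complex.Im (f x)) ->
  (forall x, `|f x| <= M%:C) -> f 0 = 1 ->
  completely_monotonic 0%E +oo%E w ->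
  (forall y : R, 0 < y -> af%:C + cauchyK f ('i * y%:C) = (w y)%:C) ->
  absolutely_monotonic -oo%E 0%E v ->
  (forall y : R, y < 0 -> - (af%:C + cauchyK f ('i * y%:C)) = (v y)%:C) ->
  characteristic_function f.
Proof.
move=> cu cv fM f0 wcm wK vam vK.
have {vam} vcm : completely_monotonic 0%E +oo%E (fun x => v (- x)).
  by move: vam; rewrite /absolutely_monotonic oppe0.
have [uM vM] := complex_norm_bound fM.
move: (fun y eps => @cauchyK_imaginary _ f M y eps cu cv uM vM) => KE.
have pi0 : pi != 0 :> R by rewrite gt_eqF// pi_gt0.
pose u x := complex.Re (f x); pose b x := complex.Im (f x).
pose A y := pi^-1 * (y * poisson u y); pose B y := pi^-1 * conjugate b y.
(* Real parts express [w] and [v] through [A] and [B]; the vanishing imaginary parts at i y and -i y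
   give the sum and the difference of two terms, which therefore both vanish. *)
have wE y : 0 < y -> w y = af + A y - B y /\ conjugate u y + y * poisson b y = 0.
  move=> y0; have := wK y y0; have := KE y 1 y0; rewrite expr1n mul1r => ->//.
  move/eqP; rewrite eq_complex/= => /andP[/eqP e1 /eqP e2]; split.
    rewrite -e1 /A /B -/u -/b; ring.
  move: e2; rewrite -/u -/b add0r => /eqP; rewrite mulf_eq0 invr_eq0 (negbTE pi0)/=.
  by move/eqP.
have vE y : 0 < y -> v (- y) = - af + A y + B y /\ conjugate u y - y * poisson b y = 0.
  move=> y0; have := vK (- y); rewrite oppr_lt0 => /(_ y0).
  have := KE y (-1) y0; rewrite sqrrN expr1n mulN1r => ->//.
  move/eqP; rewrite eq_complex/= => /andP[/eqP e1 /eqP e2]; split.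
    rewrite -e1 /A /B -/u -/b; ring.
  move: e2; rewrite -/u -/b add0r => /eqP.
  rewrite oppr_eq0 mulf_eq0 invr_eq0 (negbTE pi0)/= mulNr.
  by move/eqP.
have w0 y : 0 < y -> 0 <= w y.
  by move=> y0; have := wcm.2 0 y; rewrite lte_fin ltry expr0 mul1r; exact.
have v0 y : 0 < y -> 0 <= v (- y).
  by move=> y0; have := vcm.2 0 y; rewrite lte_fin ltry expr0 mul1r; exact.
have M0 : 0 <= M by exact: le_trans (uM 0).
have AM y : 0 < y -> A y <= M.
  move=> y0; rewrite /A mulrC ler_pdivrMr ?pi_gt0//.
  exact: le_trans (ler_norm _) (poisson_bound cu uM y0).
(* [w y] and [v (- y)] are nonnegative with sum 2 A y <= 2 M; the added 1 makes the bound positive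
   even if M = 0. *)
have C0 : 0 < 2 * M + 1 by lra.
have wC y : 0 < y -> w y <= 2 * M + 1.
  by move=> y0; have := AM y y0; have := v0 y y0; rewrite (wE y y0).1 (vE y y0).1; lra.
have vC y : 0 < y -> v (- y) <= 2 * M + 1.
  by move=> y0; have := AM y y0; have := w0 y y0; rewrite (wE y y0).1 (vE y y0).1; lra.
have [d1 [T1 [P1 [Z1 [mZ1 Z10 PZ1]]]]] := bernstein_half wcm C0 wC.
have [d2 [T2 [P2 [Z2 [mZ2 Z20 PZ2]]]]] := bernstein_half vcm C0 vC.
have mNZ2 : measurable_fun setT (fun s => - Z2 s) by exact: measurableT_comp.
(* The law of Z1 on the positive side and the reflected law of Z2 on the negative side. *)
have [m mE] := sum_of_laws P1 P2 mZ1 mNZ2.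
have mabs : measurable_fun [set: R] (fun s : R => `|s|) by exact: measurableT_comp.
have e1 (y s : R) : 0 < y -> `|expR (- y * `|s|)| <= 1.
  move=> y0; rewrite ger0_norm ?expR_ge0// -[leRHS]expR0 ler_expR mulNr oppr_le0.
  by rewrite mulr_ge0// ltW.
have me (y : R) : measurable_fun [set: R] (fun s : R => expR (- y * `|s|)).
  by apply: measurableT_comp => //; exact: measurable_funM.
have expE y : 0 < y -> \int[m]_s expR (- y * `|s|) = A y.
  move=> y0; rewrite (mE _ 1)//; last by move=> s; exact: e1.
  under eq_Rintegral do rewrite ger0_norm//.
  under [X in _ + X]eq_Rintegral do rewrite normrN ger0_norm//.
  by rewrite PZ1// PZ2// (wE y y0).1 (vE y y0).1; lra.
have sg1 (s : R) : `|Num.sg s| <= 1 by rewrite normr_sg; case: (s != 0).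
have sgE (z y : R) : 0 <= z ->
    Num.sg z * (expR (- z) - expR (- y * z)) = expR (- 1 * z) - expR (- y * z).
  rewrite le_eqVlt => /orP[/eqP <-|z0]; last by rewrite gtr0_sg// mul1r mulN1r.
  by rewrite sgr0 mul0r !mulr0 subrr.
have B1 : B 1 = 0.
  rewrite /B /conjugate; under eq_Rintegral do rewrite expr1n subrr mulr0.
  by rewrite Rintegral_cst//= mul0r mulr0.
have ie d (T : measurableType d) (P : {finite_measure set T -> \bar R}) (Z : T -> R) (y : R) :
    measurable_fun setT Z -> (forall s, 0 <= Z s) -> 0 < y ->
    P.-integrable setT (EFin \o (fun s => expR (- y * Z s))).
  move=> mZ Z0 y0; apply: (@finite_integrable_bounded _ _ _ _ 1) => [|s].
    by apply: measurableT_comp => //; exact: measurable_funM.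
  by have := e1 y (Z s) y0; rewrite (ger0_norm (Z0 s)).
(* Half the difference of [w y] and [v (- y)] is af - B y; subtracting its values at 1 and y
   eliminates [af], and B 1 = 0. An atom at 0 is harmless, since there the two exponentials
   cancel. *)
have sgexpE y : 0 < y ->
    \int[m]_s (Num.sg s * (expR (- `|s|) - expR (- y * `|s|))) = B y.
  move=> y0; rewrite (mE _ (1 * (1 + 1))); last 2 first.
  - apply: measurable_funM; first exact: measurable_sgr.
    apply: measurable_funB => //; apply: measurableT_comp => //; exact: measurableT_comp.
  - move=> s; rewrite normrM ler_pM//; apply: le_trans (ler_normB _ _) _.
    by apply: lerD; [have := e1 1 s ltr01; rewrite mulN1r|exact: e1].
  under eq_Rintegral do rewrite ger0_norm// sgE//.
  under [X in _ + X]eq_Rintegral do rewrite normrN ger0_norm// sgrN mulNr sgE// -mulN1r.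
  have i1 := ie _ _ P1 Z1 _ mZ1 Z10; have i2 := ie _ _ P2 Z2 _ mZ2 Z20.
  rewrite RintegralB//; [|exact: i1..].
  rewrite RintegralZl//; last first.
    by have := integrableB measurableT (i2 _ ltr01) (i2 _ y0); apply: eq_integrable.
  rewrite RintegralB//; [|exact: i2..].
  rewrite !PZ1// !PZ2//.
  by rewrite (wE y y0).1 (vE y y0).1 (wE _ ltr01).1 (vE _ ltr01).1 B1; lra.
have mid : measurable_fun [set: R] (fun s : R => s) by exact: measurable_id.
have b0 y : 0 < y -> poisson b y = 0.
  move=> y0; have H1 := (wE y y0).2; have H2 := (vE y y0).2.
  have : y * poisson b y = 0 by lra.
  by move/eqP; rewrite mulf_eq0 gt_eqF//= => /eqP.
have u0 y : 0 < y -> conjugate u y = 0.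
  by move=> y0; have := (wE y y0).2; rewrite b0// mulr0 addr0.
apply: (characteristic_function_of_finite_measure (m := m)) => //.
  apply: (poisson_conjugate_inj cu uM (@cos_transform_continuous _ _ _ m _ mid)
    (@cos_transform_bounded _ _ _ m _ mid)) => y y0.
    rewrite (@poisson_cos _ _ _ m _ mid y y0) expE// /A.
    by have y1 : y != 0 by [rewrite gt_eqF]; rewrite mulrA mulrAC mulrA divfK// mulrAC divff// mul1r.
  by rewrite (@conjugate_cos _ _ _ m _ mid y y0) u0.
apply: (poisson_conjugate_inj cv vM (@sin_transform_continuous _ _ _ m _ mid)
  (@sin_transform_bounded _ _ _ m _ mid)) => y y0.
  by rewrite (@poisson_sin _ _ _ m _ mid y y0) b0.
by rewrite (@conjugate_sin _ _ _ m _ mid y y0) sgexpE// /B mulrA divff// mul1r.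
Qed.

End CharacteristicFunctions.

Theorem theorem2 (R : realType) (f : R -> R[i]) :
  continuous (fun x : R => complex.Re (f x)) ->
  continuous (fun x : R => complex.Im (f x)) ->
  (exists M : R, forall x, `|f x| <= M%:C) ->
  f 0 = 1 ->
  (characteristic_function f <->
   exists af : R,
     (exists w : R -> R,
        completely_monotonic 0%E +oo%E w /\
        forall y : R, 0 < y -> af%:C + cauchyK f ('i * y%:C) = (w y)%:C) /\
     (exists v : R -> R,
        absolutely_monotonic -oo%E 0%E v /\
        forall y : R, y < 0 -> - (af%:C + cauchyK f ('i * y%:C)) = (v y)%:C)).
Proof.
move=> cu cv [M fM] f0; split.
  exact: characteristic_function_completely_monotonic.
move=> [af [[w [wcm wK]] [v [vam vK]]]].
exact: (completely_monotonic_characteristic_function cu cv fM f0 wcm wK vam vK).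
Qed.
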